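(* Let $h$ be a Lorentzian metric on the torus $\mathbf T^2$ such that the curvature of $h$ is constant along (i.e. constant on each leaf of) one of the two lightlike foliations of $h$. Then $h$ is flat.
   Context: A smooth Lorentzian metric on a surface has, at each point, exactly two lightlike (isotropic) directions. A lightlike foliation of $h$ is a one-dimensional foliation whose leaves are everywhere tangent to a lightlike direction of $h$. The curvature of $h$ is its sectional (Gauss) curvature function, a smooth function on $\mathbf T^2$. *)

(* Defs.v *)
From Stdlib Require Import Reals.
From Coquelicot Require Import Coquelicot.

Open Scope R_scope.

(* The torus is T^2 = R^2/Z^2.  Every object on it (function, tensor field,
   line field) is represented by its lift to the universal cover R^2, that is,
   by a Z^2-periodic object written in the coordinates (x, y). *)

Inductive axis : Set := ax | ay.

Definition sum_axis (f : axis -> R) : R := f ax + f ay.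

Definition scalar_field : Type := R -> R -> R.

Definition vec : Type := axis -> R.

Definition vector_field : Type := axis -> scalar_field.

(* h i j is the component h(d_i, d_j). *)
Definition tensor2_field : Type := axis -> axis -> scalar_field.

Definition periodic (f : scalar_field) : Prop :=
  forall x y : R, f (x + 1) y = f x y /\ f x (y + 1) = f x y.

(* Partial derivatives of every order exist and are continuous; this is
   C^infinity regularity when it holds at all points of an open set. *)
Definition smooth_at (f : scalar_field) (x y : R) : Prop :=
  forall n : nat, ex_diff_n f n x y.

Definition partial (i : axis) (f : scalar_field) : scalar_field :=
  fun x y =>
    match i with
    | ax => Derive (fun t => f t y) x
    | ay => Derive (fun t => f x t) y
    end.

Definition apply2 (h : tensor2_field) (x y : R) (v w : vec) : R :=
  sum_axis (fun i => sum_axis (fun j => h i j x y * v i * w j)).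

(* Signature (1,1): there is an orthogonal basis normalized to -1, +1
   (linear independence follows from the three equations). *)
Definition lorentzian_at (h : tensor2_field) (x y : R) : Prop :=
  exists v w : vec,
    apply2 h x y v v = -1 /\ apply2 h x y w w = 1 /\ apply2 h x y v w = 0.

Record lorentzian_metric (h : tensor2_field) : Prop := {
  metric_smooth : forall i j x y, smooth_at (h i j) x y;
  metric_periodic : forall i j, periodic (h i j);
  metric_sym : forall i j x y, h i j x y = h j i x y;
  metric_signature : forall x y, lorentzian_at h x y
}.

Definition metric_det (h : tensor2_field) : scalar_field :=
  fun x y => h ax ax x y * h ay ay x y - h ax ay x y * h ay ax x y.

Definition metric_inv (h : tensor2_field) : tensor2_field :=
  fun i j x y =>
    match i, j with
    | ax, ax => h ay ay x y / metric_det h x y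
    | ay, ay => h ax ax x y / metric_det h x y
    | _, _ => - h i j x y / metric_det h x y
    end.

(* Levi-Civita connection: nabla_{d_i} d_j = sum_k (christoffel h k i j) d_k. *)
Definition christoffel (h : tensor2_field) (k i j : axis) : scalar_field :=
  fun x y =>
    / 2 * sum_axis (fun l =>
      metric_inv h k l x y *
      (partial i (h j l) x y + partial j (h i l) x y - partial l (h i j) x y)).

(* R(d_i, d_j) d_k = sum_l (riemann h l k i j) d_l, with the convention
   R(X, Y) = [nabla_X, nabla_Y] - nabla_[X, Y]. *)
Definition riemann (h : tensor2_field) (l k i j : axis) : scalar_field :=
  fun x y =>
    partial i (christoffel h l j k) x y - partial j (christoffel h l i k) x y
    + sum_axis (fun m =>
        christoffel h l i m x y * christoffel h m j k x y
        - christoffel h l j m x y * christoffel h m i k x y).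

(* h(R(X, Y) Y, X) / (h(X, X) h(Y, Y) - h(X, Y)^2) for X = d_x, Y = d_y. *)
Definition curvature (h : tensor2_field) : scalar_field :=
  fun x y =>
    sum_axis (fun l => riemann h l ay ax ay x y * h l ax x y) / metric_det h x y.

Definition flat (h : tensor2_field) : Prop :=
  forall (l k i j : axis) (x y : R), riemann h l k i j x y = 0.

(* A one-dimensional foliation is given by its smooth tangent line field:
   L x y is the set of vectors tangent to the foliation at (x, y).  The line
   field is not assumed to be orientable on the torus. *)
Definition line_field : Type := R -> R -> vec -> Prop.

Definition spanned_at (L : line_field) (V : vector_field) (x y : R) : Prop :=
  (exists i, V i x y <> 0) /\
  (forall w : vec, L x y w <-> exists c : R, forall i, w i = c * V i x y).

Record foliation (L : line_field) : Prop := {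
  foliation_smooth : forall x0 y0 : R, exists V : vector_field,
    locally_2d (fun x y => (forall i, smooth_at (V i) x y) /\ spanned_at L V x y)
      x0 y0;
  foliation_periodic : forall (x y : R) (w : vec),
    (L (x + 1) y w <-> L x y w) /\ (L x (y + 1) w <-> L x y w)
}.

Definition lightlike_foliation (h : tensor2_field) (L : line_field) : Prop :=
  foliation L /\
  forall (x y : R) (w : vec), L x y w -> apply2 h x y w w = 0.

Definition tangent_curve (L : line_field) (c : axis -> R -> R) : Prop :=
  forall t : R,
    (forall i, ex_derive (c i) t) /\
    L (c ax t) (c ay t) (fun i => Derive (c i) t).

(* (x1, y1) belongs to the leaf through (x0, y0).  The leaves on the torus are
   the projections of these leaves on the universal cover. *)
Definition leaf (L : line_field) (x0 y0 x1 y1 : R) : Prop :=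
  exists c : axis -> R -> R,
    tangent_curve L c /\
    c ax 0 = x0 /\ c ay 0 = y0 /\ c ax 1 = x1 /\ c ay 1 = y1.

Definition constant_on_leaves (L : line_field) (f : scalar_field) : Prop :=
  forall x0 y0 x1 y1 : R, leaf L x0 y0 x1 y1 -> f x1 y1 = f x0 y0.

(* Main.v *)
Require Import Defs.
From Stdlib Require Import Reals ZArith Lra Lia FunctionalExtensionality.
From Coquelicot Require Import Coquelicot.
Open Scope R_scope.

(* Let K be the curvature.  A direction along which K is constant is null, so dK
   vanishes on a null line and hence is a null covector: |grad K|^2 = 0.
   Differentiating, Hess K kills the null vector grad K, so where dK <> 0 it has
   the form b dK (x) dK, and the Ricci identity says that b satisfies
   (grad K) b = K.  Such a b cannot exist on a compact surface: with the
   divergence-free field grad K, integrating div (K arctan(b) grad K) gives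
   int K^2 / (1 + b^2) = 0.  As b blows up at the critical points, it is
   regularized to b_e = S / (N + e), where N = K_x^2 + K_y^2 and S is the Euclidean
   trace of Hess K (so that b = S / N), and e tends to 0.  The result is
   K dK = 0, so K is constant, and Gauss-Bonnet (the curvature form is the
   differential of the connection form of the null line bundle, trivialized up to
   sign by Euclidean unit vectors) forces K = 0. *)

(** * Smooth and periodic functions of two variables *)

(** The hypothesis speaks of leaves only, so before any derivative of [K] is known to vanish, an
    integral curve through each point has to be built; this is what the local existence theorem is
    for. In the integral identity the factor [K] is free, because [K] is constant along its own null
    gradient, and it turns [(grad K) b = K] into the signed quantity [K ^ 2]; the arctangent tames
    the growth of [b]. That [grad K] is divergence-free means that the Laplacian of [K] vanishes;
    this needs a separate argument at critical points, where the rank-one form of the Hessian says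
    nothing. The regularization error is harmless because [grad K] kills the Hessian: in
    [(grad K) N] only Christoffel terms survive, which are cubic in [dK], so it is [O(N ^ (3/2))].
    Nothing is known about the set of critical points, so the Hessian identities are multiplied
    through by powers of [N] and hold everywhere. The Euclidean norm and trace are legitimate
    auxiliaries: they are invariant under translations, hence defined on the torus. *)

Definition smooth (f : scalar_field) : Prop := forall x y, smooth_at f x y.

(** Regularity of finite order, since the closure properties are proved by induction on the
    order. *)
Definition class_C (n : nat) (f : scalar_field) : Prop :=
  forall x y, ex_diff_n f n x y.

Definition cont2 (f : scalar_field) : Prop := forall x y, continuity_2d_pt f x y.

Definition diff1 (f : scalar_field) : Prop :=
  forall x y, ex_derive (fun t => f t y) x /\ ex_derive (fun t => f x t) y.

Lemma class_C_0 f : class_C 0 f <-> cont2 f.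
Proof. split; intros H x y; [apply (H x y)|split; [apply H|exact I]]. Qed.

Lemma class_C_S n f :
  class_C (S n) f <->
  cont2 f /\ diff1 f /\ class_C n (partial ax f) /\ class_C n (partial ay f).
Proof.
  split.
  - intros H. repeat split; try (apply (H x y)); intros x y; apply (H x y).
  - intros (H0 & H1 & H2 & H3) x y. simpl.
    exact (conj (H0 x y) (conj (proj1 (H1 x y)) (conj (proj2 (H1 x y))
             (conj (H2 x y) (H3 x y))))).
Qed.

Lemma class_C_le n m f : (m <= n)%nat -> class_C n f -> class_C m f.
Proof. intros Hm H x y. now apply ex_diff_n_m with n. Qed.

Lemma class_C_pred n f : class_C (S n) f -> class_C n f.
Proof. apply class_C_le; lia. Qed.

Lemma class_C_cont2 n f : class_C n f -> cont2 f.
Proof. intros H. apply class_C_0. apply class_C_le with n; [lia|exact H]. Qed.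

Lemma partial_const i c x y : partial i (fun _ _ => c) x y = 0.
Proof. destruct i; [exact (Derive_const c x)|exact (Derive_const c y)]. Qed.

Lemma partial_plus_diff1 i f g x y : diff1 f -> diff1 g ->
  partial i (fun u v => f u v + g u v) x y = partial i f x y + partial i g x y.
Proof.
  intros Hf Hg. destruct (Hf x y), (Hg x y).
  destruct i; simpl;
    [apply (Derive_plus (fun t => f t y) (fun t => g t y))
    |apply (Derive_plus (fun t => f x t) (fun t => g x t))]; assumption.
Qed.

Lemma partial_opp i f x y : partial i (fun u v => - f u v) x y = - partial i f x y.
Proof.
  destruct i; simpl;
    [apply (Derive_opp (fun t => f t y))|apply (Derive_opp (fun t => f x t))].
Qed.

Lemma partial_mult_diff1 i f g x y : diff1 f -> diff1 g ->
  partial i (fun u v => f u v * g u v) x y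
  = partial i f x y * g x y + f x y * partial i g x y.
Proof.
  intros Hf Hg. destruct (Hf x y), (Hg x y).
  destruct i; simpl;
    [apply (Derive_mult (fun t => f t y) (fun t => g t y))
    |apply (Derive_mult (fun t => f x t) (fun t => g x t))]; assumption.
Qed.

Lemma partial_comp_diff1 i (phi dphi : R -> R) f x y :
  diff1 f -> is_derive phi (f x y) (dphi (f x y)) ->
  partial i (fun u v => phi (f u v)) x y = dphi (f x y) * partial i f x y.
Proof.
  intros Hf Hp. destruct (Hf x y) as [H1 H2]. rewrite Rmult_comm.
  destruct i; simpl; apply is_derive_unique.
  - apply (is_derive_comp phi (fun t => f t y)); [exact Hp|].
    now apply Derive_correct.
  - apply (is_derive_comp phi (fun t => f x t)); [exact Hp|].
    now apply Derive_correct.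
Qed.

Lemma diff1_comp (phi dphi : R -> R) f :
  diff1 f -> (forall x y, is_derive phi (f x y) (dphi (f x y))) ->
  diff1 (fun u v => phi (f u v)).
Proof.
  intros Hf Hp x y. destruct (Hf x y) as [H1 H2]. split.
  - apply (ex_derive_comp phi (fun t => f t y)); [|exact H1].
    eexists; apply Hp.
  - apply (ex_derive_comp phi (fun t => f x t)); [|exact H2].
    eexists; apply Hp.
Qed.

Lemma cont2_comp (phi dphi : R -> R) f :
  cont2 f -> (forall x y, is_derive phi (f x y) (dphi (f x y))) ->
  cont2 (fun u v => phi (f u v)).
Proof.
  intros Hf Hp x y. apply continuity_1d_2d_pt_comp; [|apply Hf].
  apply derivable_continuous_pt. exists (dphi (f x y)). now apply is_derive_Reals.
Qed.

Lemma class_C_const n c : class_C n (fun _ _ => c).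
Proof.
  revert c; induction n as [|n IH]; intros c.
  - apply class_C_0. intros x y. apply continuity_2d_pt_const.
  - apply class_C_S. split; [|split; [|split]].
    + intros x y. apply continuity_2d_pt_const.
    + intros x y; split; apply ex_derive_const.
    + replace (partial ax (fun _ _ => c)) with (fun _ _ : R => 0); [apply IH|].
      extensionality x; extensionality y. symmetry; apply partial_const.
    + replace (partial ay (fun _ _ => c)) with (fun _ _ : R => 0); [apply IH|].
      extensionality x; extensionality y. symmetry; apply partial_const.
Qed.

Lemma class_C_S_ext n f (df : axis -> scalar_field) :
  cont2 f -> diff1 f -> (forall i x y, partial i f x y = df i x y) ->
  (forall i, class_C n (df i)) -> class_C (S n) f.
Proof.
  intros H1 H2 H3 H4. apply class_C_S. split; [|split; [|split]]; auto;
  (match goal with |- class_C _ (partial ?i _) =>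
     replace (partial i f) with (df i); [apply H4|] end;
   extensionality x; extensionality y; symmetry; apply H3).
Qed.

Lemma diff1_plus f g : diff1 f -> diff1 g -> diff1 (fun x y => f x y + g x y).
Proof.
  intros Hf Hg x y. destruct (Hf x y), (Hg x y). split.
  - apply (ex_derive_plus (fun t => f t y) (fun t => g t y)); assumption.
  - apply (ex_derive_plus (fun t => f x t) (fun t => g x t)); assumption.
Qed.

Lemma diff1_mult f g : diff1 f -> diff1 g -> diff1 (fun x y => f x y * g x y).
Proof.
  intros Hf Hg x y. destruct (Hf x y), (Hg x y). split.
  - apply (ex_derive_mult (fun t => f t y) (fun t => g t y)); assumption.
  - apply (ex_derive_mult (fun t => f x t) (fun t => g x t)); assumption.
Qed.

Lemma class_C_plus n f g :
  class_C n f -> class_C n g -> class_C n (fun x y => f x y + g x y).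
Proof.
  revert f g; induction n as [|n IH]; intros f g Hf Hg.
  - apply class_C_0 in Hf, Hg. apply class_C_0.
    intros x y. now apply continuity_2d_pt_plus.
  - apply class_C_S in Hf, Hg.
    destruct Hf as (F0 & F1 & F2 & F3), Hg as (G0 & G1 & G2 & G3).
    apply class_C_S_ext with (fun i x y => partial i f x y + partial i g x y).
    + intros x y. now apply continuity_2d_pt_plus.
    + now apply diff1_plus.
    + intros i x y. now apply partial_plus_diff1.
    + intros []; now apply IH.
Qed.

Lemma class_C_mult n f g :
  class_C n f -> class_C n g -> class_C n (fun x y => f x y * g x y).
Proof.
  revert f g; induction n as [|n IH]; intros f g Hf Hg.
  - apply class_C_0 in Hf, Hg. apply class_C_0.
    intros x y. now apply continuity_2d_pt_mult.
  - pose proof (class_C_pred _ _ Hf) as Hf'. pose proof (class_C_pred _ _ Hg) as Hg'.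
    apply class_C_S in Hf, Hg.
    destruct Hf as (F0 & F1 & F2 & F3), Hg as (G0 & G1 & G2 & G3).
    apply class_C_S_ext
      with (fun i x y => partial i f x y * g x y + f x y * partial i g x y).
    + intros x y. now apply continuity_2d_pt_mult.
    + now apply diff1_mult.
    + intros i x y. now apply partial_mult_diff1.
    + intros []; apply class_C_plus; now apply IH.
Qed.

(* Bootstrapping: [phi o f] gains one derivative as soon as [phi' o f] has the
   regularity already known for [phi o f]. *)
Lemma smooth_comp (phi dphi : R -> R) f :
  smooth f -> (forall x y, is_derive phi (f x y) (dphi (f x y))) ->
  (forall n, class_C n (fun x y => phi (f x y)) ->
             class_C n (fun x y => dphi (f x y))) ->
  smooth (fun x y => phi (f x y)).
Proof.
  intros Hf Hd Hb.
  assert (Hn : forall n, class_C n (fun x y => phi (f x y))).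
  { induction n as [|n IH].
    - apply class_C_0, cont2_comp with dphi; [|exact Hd].
      apply (class_C_cont2 0). intros x y. apply Hf.
    - apply class_C_S_ext with (fun i x y => dphi (f x y) * partial i f x y).
      + apply cont2_comp with dphi; [|exact Hd].
        apply (class_C_cont2 0). intros x y. apply Hf.
      + apply diff1_comp with dphi; [|exact Hd]. intros x y.
        split; apply (Hf x y 1%nat).
      + intros i x y. apply partial_comp_diff1; [|apply Hd]. intros u v.
        split; apply (Hf u v 1%nat).
      + intros i. apply class_C_mult; [now apply Hb|].
        destruct i; intros x y; apply (Hf x y (S n)). }
  intros x y n. apply Hn.
Qed.

Lemma smooth_class_C f : smooth f <-> forall n, class_C n f.
Proof. split; [intros H n x y; apply H|intros H x y n; apply H]. Qed.

Lemma smooth_cont2 f : smooth f -> cont2 f.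
Proof. intros H. apply (class_C_cont2 0). now apply smooth_class_C. Qed.

Lemma smooth_diff1 f : smooth f -> diff1 f.
Proof. intros H x y. split; apply (H x y 1%nat). Qed.

Lemma smooth_const c : smooth (fun _ _ => c).
Proof. apply smooth_class_C. intros n. apply class_C_const. Qed.

Lemma smooth_plus f g : smooth f -> smooth g -> smooth (fun x y => f x y + g x y).
Proof.
  rewrite !smooth_class_C. intros Hf Hg n. now apply class_C_plus.
Qed.

Lemma smooth_mult f g : smooth f -> smooth g -> smooth (fun x y => f x y * g x y).
Proof.
  rewrite !smooth_class_C. intros Hf Hg n. now apply class_C_mult.
Qed.

Lemma smooth_opp f : smooth f -> smooth (fun x y => - f x y).
Proof.
  intros Hf. replace (fun x y => - f x y) with (fun x y => (-1) * f x y).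
  - apply smooth_mult; [apply smooth_const|exact Hf].
  - extensionality x; extensionality y. ring.
Qed.

Lemma smooth_minus f g : smooth f -> smooth g -> smooth (fun x y => f x y - g x y).
Proof.
  intros Hf Hg. unfold Rminus. apply smooth_plus; [|apply smooth_opp]; assumption.
Qed.

Lemma smooth_partial i f : smooth f -> smooth (partial i f).
Proof. intros Hf x y n. destruct i; apply (Hf x y (S n)). Qed.

Lemma smooth_inv f : smooth f -> (forall x y, f x y <> 0) ->
  smooth (fun x y => / f x y).
Proof.
  intros Hf Hz. apply (smooth_comp Rinv (fun u => - (/ u * / u))); [exact Hf| |].
  - intros x y. auto_derive; [apply Hz|]. field; apply Hz.
  - intros n Hn.
    replace (fun x y => - (/ f x y * / f x y))
      with (fun x y => (-1) * (/ f x y * / f x y)).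
    + apply class_C_mult; [apply class_C_const|now apply class_C_mult].
    + extensionality x; extensionality y. ring.
Qed.

Lemma smooth_div f g : smooth f -> smooth g -> (forall x y, g x y <> 0) ->
  smooth (fun x y => f x y / g x y).
Proof.
  intros Hf Hg Hz. unfold Rdiv. apply smooth_mult; [|apply smooth_inv]; assumption.
Qed.

Lemma is_derive_atan_mult x : is_derive atan x (/ (1 + x * x)).
Proof.
  replace (x * x) with (x ^ 2) by ring.
  apply is_derive_Reals, derivable_pt_lim_atan.
Qed.

Lemma smooth_atan f : smooth f -> smooth (fun x y => atan (f x y)).
Proof.
  intros Hf. apply (smooth_comp atan (fun u => / (1 + u * u))); [exact Hf| |].
  - intros x y. apply is_derive_atan_mult.
  - intros n _. revert n. apply smooth_class_C.
    apply (smooth_inv (fun x y => 1 + f x y * f x y)).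
    + apply smooth_plus; [apply smooth_const|now apply smooth_mult].
    + intros x y. nra.
Qed.

Lemma smooth_sqrt f : smooth f -> (forall x y, 0 < f x y) ->
  smooth (fun x y => sqrt (f x y)).
Proof.
  intros Hf Hp.
  assert (Hs : forall x y, sqrt (f x y) <> 0).
  { intros x y. apply Rgt_not_eq, sqrt_lt_R0, Hp. }
  (* The derivative is written with [sqrt] in the numerator: it is then [sqrt o f] times a smooth
     function, and the bootstrap applies. *)
  apply (smooth_comp sqrt (fun u => sqrt u * / (2 * u))); [exact Hf| |].
  - intros x y. specialize (Hp x y). specialize (Hs x y).
    auto_derive; [exact Hp|].
    rewrite <- (sqrt_sqrt (f x y)) at 3 by lra. field. exact Hs.
  - intros n Hn. apply class_C_mult; [exact Hn|].
    clear Hn. revert n. apply smooth_class_C.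
    apply (smooth_inv (fun x y => 2 * f x y)).
    + apply smooth_mult; [apply smooth_const|exact Hf].
    + intros x y. specialize (Hp x y). lra.
Qed.

Lemma partial_plus i f g x y : smooth f -> smooth g ->
  partial i (fun u v => f u v + g u v) x y = partial i f x y + partial i g x y.
Proof. intros. apply partial_plus_diff1; now apply smooth_diff1. Qed.

Lemma partial_minus i f g x y : smooth f -> smooth g ->
  partial i (fun u v => f u v - g u v) x y = partial i f x y - partial i g x y.
Proof.
  intros. unfold Rminus.
  rewrite (partial_plus i f (fun u v => - g u v)); [|assumption|now apply smooth_opp].
  now rewrite partial_opp.
Qed.

Lemma partial_mult i f g x y : smooth f -> smooth g ->
  partial i (fun u v => f u v * g u v) x y
  = partial i f x y * g x y + f x y * partial i g x y.
Proof. intros. apply partial_mult_diff1; now apply smooth_diff1. Qed.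

Lemma partial_inv i f x y : smooth f -> (forall u v, f u v <> 0) ->
  partial i (fun u v => / f u v) x y = - (partial i f x y) / (f x y * f x y).
Proof.
  intros Hf Hz.
  rewrite (partial_comp_diff1 i Rinv (fun u => - (/ u * / u))).
  - field. apply Hz.
  - now apply smooth_diff1.
  - auto_derive; [apply Hz|]. field; apply Hz.
Qed.

Lemma partial_div i f g x y : smooth f -> smooth g -> (forall u v, g u v <> 0) ->
  partial i (fun u v => f u v / g u v) x y
  = (partial i f x y * g x y - f x y * partial i g x y) / (g x y * g x y).
Proof.
  intros Hf Hg Hz. unfold Rdiv at 1.
  rewrite (partial_mult i f (fun u v => / g u v)); [|assumption|now apply smooth_inv].
  rewrite partial_inv by assumption. field. apply Hz.
Qed.

Lemma partial_atan i f x y : smooth f ->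
  partial i (fun u v => atan (f u v)) x y = partial i f x y / (1 + f x y * f x y).
Proof.
  intros Hf.
  rewrite (partial_comp_diff1 i atan (fun u => / (1 + u * u))).
  - unfold Rdiv; ring.
  - now apply smooth_diff1.
  - apply is_derive_atan_mult.
Qed.

Lemma partial_comm f x y : smooth f ->
  partial ay (partial ax f) x y = partial ax (partial ay f) x y.
Proof.
  intros Hf. symmetry. unfold partial. apply Schwarz.
  - exists (mkposreal 1 Rlt_0_1). intros u v _ _.
    pose proof (smooth_diff1 f Hf u v) as [H1 H2].
    pose proof (smooth_diff1 _ (smooth_partial ax f Hf) u v) as [_ H3].
    pose proof (smooth_diff1 _ (smooth_partial ay f Hf) u v) as [H4 _].
    repeat split; assumption.
  - apply (smooth_cont2 _ (smooth_partial ax _ (smooth_partial ay f Hf))).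
  - apply (smooth_cont2 _ (smooth_partial ay _ (smooth_partial ax f Hf))).
Qed.

(** * Periodicity and reduction to the unit square *)

Lemma periodic_partial i f : periodic f -> periodic (partial i f).
Proof.
  intros Hf x y.
  destruct i; split; unfold partial, Derive; f_equal; apply Lim_ext; intros t; f_equal.
  - replace (x + 1 + t) with (x + t + 1) by ring. now rewrite !(proj1 (Hf _ _)).
  - now rewrite !(proj2 (Hf _ _)).
  - now rewrite !(proj1 (Hf _ _)).
  - replace (y + 1 + t) with (y + t + 1) by ring. now rewrite !(proj2 (Hf _ _)).
Qed.

Lemma periodic_const c : periodic (fun _ _ => c).
Proof. split; reflexivity. Qed.

Lemma periodic_op1 (op : R -> R) f : periodic f -> periodic (fun x y => op (f x y)).
Proof. intros Hf x y. destruct (Hf x y) as [-> ->]. now split. Qed.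

Lemma periodic_op2 (op : R -> R -> R) f g : periodic f -> periodic g ->
  periodic (fun x y => op (f x y) (g x y)).
Proof. intros Hf Hg x y. destruct (Hf x y) as [-> ->], (Hg x y) as [-> ->]. now split. Qed.

Lemma periodic_shift_nat f (n m : nat) x y : periodic f ->
  f (x + INR n) (y + INR m) = f x y.
Proof.
  intros Hf. induction n as [|n IH].
  - simpl (INR 0). rewrite Rplus_0_r. induction m as [|m IHm].
    + simpl. now rewrite Rplus_0_r.
    + rewrite S_INR, <- Rplus_assoc. now rewrite (proj2 (Hf _ _)).
  - rewrite S_INR, <- Rplus_assoc. now rewrite (proj1 (Hf _ _)).
Qed.

(** An integer translation is split into two natural ones, because periodicity is iterated over
    [nat]. *)
Lemma shift_to_unit x : exists n m : nat, 0 <= x + INR n - INR m <= 1.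
Proof.
  destruct (archimed x) as [H1 H2].
  destruct (Z_le_gt_dec 0 (up x)) as [Hz|Hz].
  - exists 1%nat, (Z.to_nat (up x)). rewrite INR_IZR_INZ, INR_IZR_INZ, Z2Nat.id by lia.
    simpl (IZR (Z.of_nat 1)). lra.
  - exists (S (Z.to_nat (- up x))), 0%nat. rewrite S_INR, INR_IZR_INZ, Z2Nat.id by lia.
    rewrite opp_IZR. simpl (INR 0). lra.
Qed.

Lemma periodic_unit_square f (P : R -> Prop) : periodic f ->
  (forall x y, 0 <= x <= 1 -> 0 <= y <= 1 -> P (f x y)) -> forall x y, P (f x y).
Proof.
  intros Hf H x y.
  destruct (shift_to_unit x) as (n & m & Hx), (shift_to_unit y) as (p & q & Hy).
  rewrite <- (periodic_shift_nat f n p x y Hf).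
  replace (x + INR n) with (x + INR n - INR m + INR m) by ring.
  replace (y + INR p) with (y + INR p - INR q + INR q) by ring.
  rewrite (periodic_shift_nat f m q _ _ Hf). now apply H.
Qed.

(** Uniform continuity on the square gives a step size below which [f] moves by less than 1. Walking
    from the origin to [(x, y)] along the segment in [n] equal steps, with [/ INR n] below that
    size, changes [f] by at most [n]. *)
Lemma periodic_bounded f : periodic f -> cont2 f ->
  exists B, 0 < B /\ forall x y, Rabs (f x y) <= B.
Proof.
  intros Hp Hc.
  destruct (uniform_continuity_2d f 0 1 0 1 (fun x y _ _ => Hc x y)
              (mkposreal 1 Rlt_0_1)) as [d Hd]. simpl in Hd.
  destruct (archimed_cor1 d (cond_pos d)) as (n & Hn & Hn0).
  assert (Hn' : 0 < INR n) by (apply lt_0_INR; lia).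
  exists (Rabs (f 0 0) + INR n + 1). split.
  { pose proof (Rabs_pos (f 0 0)). lra. }
  apply (periodic_unit_square f (fun z => Rabs z <= _) Hp).
  intros x y Hx Hy.
  assert (Hk : forall k : nat, (k <= n)%nat ->
    Rabs (f (INR k * (x / INR n)) (INR k * (y / INR n))) <= Rabs (f 0 0) + INR k).
  { induction k as [|k IH]; intros Hk.
    - simpl. rewrite !Rmult_0_l. lra.
    - specialize (IH ltac:(lia)).
      assert (Hb : forall z, 0 <= z <= 1 -> 0 <= z / INR n < d /\
                forall j : nat, (j <= n)%nat -> 0 <= INR j * (z / INR n) <= 1).
      { intros z Hz. assert (Hq : 0 <= z / INR n).
        { apply Rmult_le_pos; [lra|]. apply Rlt_le, Rinv_0_lt_compat; lra. }
        split; [split; [exact Hq|]|].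
        - apply Rle_lt_trans with (/ INR n); [|lra].
          unfold Rdiv. rewrite <- (Rmult_1_l (/ INR n)) at 2.
          apply Rmult_le_compat_r; [|lra]. apply Rlt_le, Rinv_0_lt_compat; lra.
        - intros j Hj. apply le_INR in Hj. pose proof (pos_INR j).
          split; [now apply Rmult_le_pos|].
          apply Rle_trans with (INR n * (z / INR n)).
          + now apply Rmult_le_compat_r.
          + replace (INR n * (z / INR n)) with z by (field; lra). lra. }
      destruct (Hb x Hx) as [Hx1 Hx2], (Hb y Hy) as [Hy1 Hy2].
      assert (Hs := Hd (INR k * (x / INR n)) (INR k * (y / INR n))
        (INR (S k) * (x / INR n)) (INR (S k) * (y / INR n))
        (Hx2 k ltac:(lia)) (Hy2 k ltac:(lia)) (Hx2 (S k) Hk) (Hy2 (S k) Hk)).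
      rewrite S_INR in *.
      set (u := x / INR n) in *. set (v := y / INR n) in *.
      replace ((INR k + 1) * u - INR k * u) with u in Hs by ring.
      replace ((INR k + 1) * v - INR k * v) with v in Hs by ring.
      rewrite (Rabs_pos_eq u), (Rabs_pos_eq v) in Hs by lra.
      specialize (Hs ltac:(lra) ltac:(lra)).
      pose proof (Rabs_triang_inv (f ((INR k + 1) * u) ((INR k + 1) * v))
                    (f (INR k * u) (INR k * v))). lra. }
  specialize (Hk n (le_n n)).
  replace (INR n * (x / INR n)) with x in Hk by (field; lra).
  replace (INR n * (y / INR n)) with y in Hk by (field; lra). lra.
Qed.

(** * Integrals of slices and a vanishing criterion *)

Lemma cont2_slice_x f y : cont2 f -> forall x, continuous (fun t => f t y) x.
Proof.
  intros Hf x. apply continuity_pt_filterlim. intros e He.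
  destruct (Hf x y (mkposreal e He)) as [d Hd].
  exists d. split; [apply cond_pos|]. intros z [_ Hz].
  apply Hd; [exact Hz|]. rewrite Rminus_diag, Rabs_R0. apply cond_pos.
Qed.

Lemma cont2_ex_RInt_x f y a b : cont2 f -> ex_RInt (fun t => f t y) a b.
Proof.
  intros Hf. apply (ex_RInt_continuous (V := R_CompleteNormedModule)).
  intros z _. now apply cont2_slice_x.
Qed.

Lemma continuous_RInt_slice f y : cont2 f ->
  continuous (fun t => RInt (fun x => f x t) 0 1) y.
Proof.
  intros Hf. apply continuity_pt_filterlim. intros e He.
  assert (He2 : 0 < e / 2) by lra.
  destruct (uniform_continuity_2d_1d f 0 1 y (fun x _ => Hf x y) (mkposreal _ He2))
    as [d Hd]. simpl in Hd.
  exists d. split; [apply cond_pos|]. intros z [_ Hz]. simpl in Hz. unfold R_dist in *.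
  simpl.
  change (Rabs (RInt (fun x => f x z) 0 1 - RInt (fun x => f x y) 0 1) < e).
  assert (Hz' : y - d <= z <= y + d) by (apply Rabs_def2 in Hz; lra).
  rewrite <- (RInt_minus (V := R_CompleteNormedModule)); try now apply cont2_ex_RInt_x.
  apply Rle_lt_trans with ((1 - 0) * (e / 2)); [|lra].
  apply abs_RInt_le_const; [lra| |].
  - apply (ex_RInt_minus (V := R_NormedModule)); now apply cont2_ex_RInt_x.
  - intros t Ht. apply Rlt_le. pose proof (cond_pos d).
    apply (Hd t y t z); try lra. now rewrite Rminus_diag, Rabs_R0.
Qed.

(** The primitive of [g] is constant on the interval, so its derivative [g] vanishes at interior
    points; the endpoints, which have no two-sided neighbourhood in the interval, follow by
    continuity. *)
Lemma RInt_nonneg_zero g : (forall x, continuous g x) -> (forall x, 0 <= g x) ->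
  RInt g 0 1 <= 0 -> forall x, 0 <= x <= 1 -> g x = 0.
Proof.
  intros Hc Hp Hi.
  assert (Hint : forall a b, ex_RInt g a b).
  { intros a b. apply (ex_RInt_continuous (V := R_CompleteNormedModule)). auto. }
  assert (Hmono : forall a b, 0 <= a -> a <= b -> b <= 1 -> RInt g a b = 0).
  { intros a b Ha Hab Hb.
    pose proof (RInt_Chasles (V := R_CompleteNormedModule) g 0 a 1 (Hint _ _) (Hint _ _)) as E1.
    pose proof (RInt_Chasles (V := R_CompleteNormedModule) g a b 1 (Hint _ _) (Hint _ _)) as E2.
    change plus with Rplus in *.
    assert (0 <= RInt g 0 a) by (apply RInt_ge_0; auto).
    assert (0 <= RInt g a b) by (apply RInt_ge_0; auto).
    assert (0 <= RInt g b 1) by (apply RInt_ge_0; auto). lra. }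
  assert (Hint0 : forall x, 0 < x < 1 -> g x = 0).
  { intros x Hx.
    assert (D : is_derive (fun b => RInt g 0 b) x (g x)).
    { apply (is_derive_RInt g (fun b => RInt g 0 b) 0).
      - apply filter_forall. intros b. apply (RInt_correct g 0 b), Hint.
      - apply Hc. }
    apply is_derive_unique in D. rewrite <- D.
    transitivity (Derive (fun _ => 0) x); [|exact (Derive_const 0 x)].
    apply Derive_ext_loc.
    assert (Hd : 0 < Rmin x (1 - x)) by (apply Rmin_glb_lt; lra).
    exists (mkposreal _ Hd). intros b Hb.
    change (Rabs (b - x) < Rmin x (1 - x)) in Hb. apply Rabs_def2 in Hb.
    pose proof (Rmin_l x (1 - x)). pose proof (Rmin_r x (1 - x)).
    apply Hmono; lra. }
  intros x Hx.
  destruct (Req_dec (g x) 0) as [E|E]; [exact E|exfalso].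
  assert (Hg : 0 < g x) by (specialize (Hp x); lra).
  pose proof (Hc x) as Hcx. apply continuity_pt_filterlim in Hcx.
  destruct (Hcx (g x) Hg) as (d & Hd & Hd').
  set (t := Rmin (1/2) (d / 2)).
  assert (Ht : 0 < t <= 1/2 /\ t < d).
  { unfold t. pose proof (Rmin_l (1/2) (d/2)). pose proof (Rmin_r (1/2) (d/2)).
    assert (0 < Rmin (1/2) (d/2)) by (apply Rmin_glb_lt; lra). lra. }
  assert (Hz : exists z, 0 < z < 1 /\ x <> z /\ Rabs (z - x) < d).
  { destruct (Rlt_dec x (1/2)).
    - exists (x + t). replace (x + t - x) with t by ring. rewrite Rabs_pos_eq; lra.
    - exists (x - t / 2). replace (x - t/2 - x) with (- (t / 2)) by ring.
      rewrite Rabs_Ropp, Rabs_pos_eq; lra. }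
  destruct Hz as (z & Hz1 & Hz2 & Hz3).
  assert (Hq : R_dist (g z) (g x) < g x).
  { apply Hd'. split; [split; [exact I|exact Hz2]|exact Hz3]. }
  unfold R_dist in Hq. rewrite (Hint0 z Hz1) in Hq.
  rewrite Rminus_0_l, Rabs_Ropp, Rabs_pos_eq in Hq; lra.
Qed.

(* Integrate over a fundamental square: the divergence contributes [0]. *)
Lemma divergence_dominated_zero (rho : scalar_field) :
  cont2 rho -> periodic rho -> (forall x y, 0 <= rho x y) ->
  (forall eta, 0 < eta -> exists U V : scalar_field,
     smooth U /\ smooth V /\ periodic U /\ periodic V /\
     forall x y, rho x y <= partial ax U x y + partial ay V x y + eta) ->
  forall x y, rho x y = 0.
Proof.
  intros Hc Hper Hpos Hdom.
  set (r := fun y => RInt (fun x => rho x y) 0 1).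
  assert (Hrc : forall y, continuous r y) by (intros y; now apply continuous_RInt_slice).
  assert (Hrp : forall y, 0 <= r y).
  { intros y. apply RInt_ge_0; [lra|now apply cont2_ex_RInt_x|auto]. }
  assert (Hr : RInt r 0 1 <= 0).
  { apply Rnot_lt_le. intros Hlt.
    (* With half of the supposedly positive integral as error, integrating the domination gives
       [RInt r 0 1 <= RInt r 0 1 / 2]. *)
    destruct (Hdom (RInt r 0 1 / 2) ltac:(lra)) as (U & V & HU & HV & PU & PV & Hle).
    set (eta := RInt r 0 1 / 2) in *.
    set (g := fun y => RInt (fun x => V x y) 0 1).
    assert (Hg : forall y, is_derive g y (RInt (fun x => partial ay V x y) 0 1)).
    { intros y.
      apply (is_derive_RInt_param (fun y x => V x y) 0 1 y).
      - apply filter_forall. intros v t _. apply (smooth_diff1 V HV).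
      - intros t _. intros e.
        destruct (smooth_cont2 _ (smooth_partial ay V HV) t y e) as [d Hd].
        exists d. intros u v Hu Hv. now apply Hd.
      - apply filter_forall. intros v. apply cont2_ex_RInt_x. now apply smooth_cont2. }
    assert (Hgc : forall y, continuous (fun y => RInt (fun x => partial ay V x y) 0 1) y).
    { intros y. apply continuous_RInt_slice, smooth_cont2, smooth_partial, HV. }
    assert (Hry : forall y, r y <= RInt (fun x => partial ay V x y) 0 1 + eta).
    { intros y.
      assert (Ux : RInt (fun x => partial ax U x y) 0 1 = 0).
      { unfold partial. rewrite RInt_Derive.
        - apply Rminus_diag_eq. rewrite <- (Rplus_0_l 1). apply (PU 0 y).
        - intros t _. exact (proj1 (smooth_diff1 U HU t y)).
        - intros t _. apply (cont2_slice_x _ y (smooth_cont2 _ (smooth_partial ax U HU))). }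
      assert (Cx : ex_RInt (fun x => partial ax U x y) 0 1).
      { apply cont2_ex_RInt_x, smooth_cont2, smooth_partial, HU. }
      assert (Cy : ex_RInt (fun x => partial ay V x y) 0 1).
      { apply cont2_ex_RInt_x, smooth_cont2, smooth_partial, HV. }
      assert (Cc : ex_RInt (fun _ : R => eta) 0 1) by apply ex_RInt_const.
      assert (Cxy : ex_RInt (fun x => partial ax U x y + partial ay V x y) 0 1)
        by now apply (ex_RInt_plus (V := R_NormedModule)).
      apply Rle_trans with
        (RInt (fun x => partial ax U x y + partial ay V x y + eta) 0 1).
      - apply RInt_le; [lra|now apply cont2_ex_RInt_x| |intros x _; apply Hle].
        now apply (ex_RInt_plus (V := R_NormedModule)).
      - rewrite (RInt_plus (V := R_CompleteNormedModule)
          (fun x => partial ax U x y + partial ay V x y) (fun _ => eta)) by assumption.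
        rewrite (RInt_plus (V := R_CompleteNormedModule)) by assumption.
        rewrite Ux, RInt_const. unfold plus, scal; simpl. unfold mult; simpl. lra. }
    assert (Hi : RInt (fun y => RInt (fun x => partial ay V x y) 0 1) 0 1 = 0).
    { rewrite (RInt_ext _ (Derive g)).
      - rewrite RInt_Derive.
        + apply Rminus_diag_eq. unfold g. apply RInt_ext. intros x _.
          rewrite <- (Rplus_0_l 1). apply (PV x 0).
        + intros y _. eexists; apply Hg.
        + intros y _. eapply continuous_ext; [|apply Hgc].
          intros z. symmetry. apply is_derive_unique, Hg.
      - intros y _. symmetry. apply is_derive_unique, Hg. }
    assert (Cg : ex_RInt (fun y => RInt (fun x => partial ay V x y) 0 1) 0 1).
    { apply (ex_RInt_continuous (V := R_CompleteNormedModule)). auto. }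
    assert (Cc : ex_RInt (fun _ : R => eta) 0 1) by apply ex_RInt_const.
    assert (RInt r 0 1 <=
      RInt (fun y => RInt (fun x => partial ay V x y) 0 1 + eta) 0 1).
    { apply RInt_le; [lra| | |auto].
      - apply (ex_RInt_continuous (V := R_CompleteNormedModule)). auto.
      - now apply (ex_RInt_plus (V := R_NormedModule)). }
    rewrite (RInt_plus (V := R_CompleteNormedModule)
      (fun y => RInt (fun x => partial ay V x y) 0 1) (fun _ => eta)) in H by assumption.
    rewrite Hi, RInt_const in H.
    change (RInt r 0 1 <= 0 + (1 - 0) * (RInt r 0 1 / 2)) in H. lra. }
  apply (periodic_unit_square rho (fun z => z = 0) Hper). intros x y Hx Hy.
  apply (RInt_nonneg_zero (fun t => rho t y)); auto.
  - now apply cont2_slice_x.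
  - exact (Req_le _ _ (RInt_nonneg_zero r Hrc Hrp Hr y Hy)).
Qed.

(** * Local solutions of scalar differential equations *)

Lemma lipschitz_continuous u B x : 0 <= B ->
  (forall s t, Rabs (u s - u t) <= B * Rabs (s - t)) -> continuous u x.
Proof.
  intros HB Hu. apply continuity_pt_filterlim. intros e He.
  exists (e / (B + 1)). split; [apply Rdiv_lt_0_compat; lra|].
  intros z [_ Hz]. simpl in *. unfold R_dist in *.
  apply Rle_lt_trans with (B * Rabs (z - x)); [apply Hu|].
  pose proof (Rabs_pos (z - x)).
  apply Rle_lt_trans with ((B + 1) * Rabs (z - x)); [nra|].
  apply (Rmult_lt_compat_l (B + 1)) in Hz; [|lra].
  replace ((B + 1) * (e / (B + 1))) with e in Hz by (field; lra). exact Hz.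
Qed.

Lemma abs_RInt_le_const_any g M a b : (forall t, continuous g t) ->
  (forall t, Rabs (g t) <= M) -> Rabs (RInt g a b) <= M * Rabs (b - a).
Proof.
  intros Hc HM.
  assert (Hi : forall p q, ex_RInt g p q).
  { intros p q. apply (ex_RInt_continuous (V := R_CompleteNormedModule)). auto. }
  destruct (Rle_dec a b) as [H|H].
  - rewrite (Rabs_pos_eq (b - a)), Rmult_comm by lra.
    apply abs_RInt_le_const; auto.
  - rewrite <- (opp_RInt_swap (V := R_CompleteNormedModule)) by apply Hi.
    change (Rabs (- RInt g b a) <= M * Rabs (b - a)).
    rewrite Rabs_Ropp, Rabs_minus_sym, (Rabs_pos_eq (a - b)), Rmult_comm by lra.
    apply abs_RInt_le_const; auto. lra.
Qed.

(** For [d >= 0], the 1-Lipschitz retraction of the line onto [[c - d, c + d]]. Precomposing with it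
    turns estimates on a box into global ones. *)
Definition clamp (c d x : R) : R := Rmax (c - d) (Rmin (c + d) x).

Lemma clamp_lipschitz c d x y : Rabs (clamp c d x - clamp c d y) <= Rabs (x - y).
Proof.
  unfold clamp, Rmin. destruct (Rle_dec (c + d) x), (Rle_dec (c + d) y);
  unfold Rmax;
  repeat (match goal with |- context [Rle_dec ?a ?b] => destruct (Rle_dec a b) end);
  unfold Rabs;
  repeat (match goal with |- context [Rcase_abs ?a] => destruct (Rcase_abs a) end); lra.
Qed.

Lemma clamp_dist c d x : 0 <= d -> Rabs (clamp c d x - c) <= d.
Proof.
  intros Hd. unfold clamp, Rmin. apply Rabs_le. destruct (Rle_dec (c + d) x);
  unfold Rmax;
  repeat (match goal with |- context [Rle_dec ?a ?b] => destruct (Rle_dec a b) end); lra.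
Qed.

Lemma clamp_id c d x : Rabs (x - c) <= d -> clamp c d x = x.
Proof.
  intros H. apply Rabs_le_between in H. unfold clamp, Rmin. destruct (Rle_dec (c + d) x);
  unfold Rmax;
  repeat (match goal with |- context [Rle_dec ?a ?b] => destruct (Rle_dec a b) end); lra.
Qed.

Lemma cont2_along f u : cont2 f -> (forall t, continuous u t) ->
  forall t, continuous (fun s => f s (u s)) t.
Proof.
  intros Hf Hu t. apply continuity_pt_filterlim. intros e He.
  destruct (Hf t (u t) (mkposreal e He)) as [d Hd].
  pose proof (Hu t) as Hut. apply continuity_pt_filterlim in Hut.
  destruct (Hut d (cond_pos d)) as (a & Ha & Ha').
  exists (Rmin a d). split; [apply Rmin_glb_lt; [exact Ha|apply cond_pos]|].
  intros z [Hz1 Hz2]. simpl in Hz2. unfold R_dist in Hz2.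
  pose proof (Rmin_l a d). pose proof (Rmin_r a d).
  apply Hd; [lra|]. apply Ha'. split; [exact Hz1|]. simpl; unfold R_dist; lra.
Qed.

Fixpoint picard (f : R -> R -> R) (x0 y0 d : R) (n : nat) (x : R) : R :=
  match n with
  | O => y0
  | S n => y0 + RInt (fun t => f t (picard f x0 y0 d n t)) x0 (clamp x0 d x)
  end.

(* Clamping the upper limit of integration makes all estimates global in [x]. *)
Lemma picard_global (f : R -> R -> R) x0 y0 B L d :
  cont2 f -> 0 <= B -> 0 <= L -> 0 < d -> L * d <= 1 / 2 ->
  (forall x y, Rabs (f x y) <= B) ->
  (forall x y z, Rabs (f x y - f x z) <= L * Rabs (y - z)) ->
  exists u : R -> R, (forall x, continuous u x) /\
    forall x, u x = y0 + RInt (fun t => f t (u t)) x0 (clamp x0 d x).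
Proof.
  intros Hf HB HL Hd HLd Hb Hl. set (u := picard f x0 y0 d).
  assert (Hstep : forall v, (forall x, continuous v x) -> forall s t,
    Rabs ((y0 + RInt (fun t => f t (v t)) x0 (clamp x0 d s))
          - (y0 + RInt (fun t => f t (v t)) x0 (clamp x0 d t))) <= B * Rabs (s - t)).
  { intros v Hv s t.
    assert (Hi : forall a b, ex_RInt (fun t => f t (v t)) a b).
    { intros a b. apply (ex_RInt_continuous (V := R_CompleteNormedModule)).
      intros z _. now apply cont2_along. }
    pose proof (RInt_Chasles (V := R_CompleteNormedModule) _ x0 (clamp x0 d t)
      (clamp x0 d s) (Hi _ _) (Hi _ _)) as E. change plus with Rplus in E.
    rewrite <- E.
    assert (Hr : forall p q r : R, p + (q + r) - (p + q) = r) by (intros; ring).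
    rewrite Hr.
    apply Rle_trans with (B * Rabs (clamp x0 d s - clamp x0 d t)).
    - apply abs_RInt_le_const_any; [now apply cont2_along|auto].
    - apply Rmult_le_compat_l; [exact HB|apply clamp_lipschitz]. }
  assert (Hlip : forall n, (forall x, continuous (u n) x) /\
    forall s t, Rabs (u n s - u n t) <= B * Rabs (s - t)).
  { induction n as [|n [IHc _]].
    - split; [intros x; apply continuous_const|].
      intros s t. simpl. rewrite Rminus_diag, Rabs_R0.
      apply Rmult_le_pos; [exact HB|apply Rabs_pos].
    - assert (H : forall s t, Rabs (u (S n) s - u (S n) t) <= B * Rabs (s - t)).
      { apply (Hstep (u n) IHc). }
      split; [|exact H]. intros x. now apply lipschitz_continuous with B. }
  (* The bound [L * d <= 1 / 2] makes the Picard operator halve uniform distances. *)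
  assert (Hcontr : forall v w D, (forall x, continuous v x) -> (forall x, continuous w x) ->
    (forall x, Rabs (v x - w x) <= D) -> forall x,
    Rabs ((y0 + RInt (fun t => f t (v t)) x0 (clamp x0 d x))
          - (y0 + RInt (fun t => f t (w t)) x0 (clamp x0 d x))) <= D / 2).
  { intros v w D Hv Hw HD x.
    assert (HD0 : 0 <= D) by (apply Rle_trans with (2 := HD 0), Rabs_pos).
    assert (E : RInt (fun t => f t (v t) - f t (w t)) x0 (clamp x0 d x)
      = RInt (fun t => f t (v t)) x0 (clamp x0 d x)
        - RInt (fun t => f t (w t)) x0 (clamp x0 d x)).
    { apply (RInt_minus (V := R_CompleteNormedModule));
        apply (ex_RInt_continuous (V := R_CompleteNormedModule));
        intros z _; now apply cont2_along. }
    assert (Hr : forall p q r : R, p + q - (p + r) = q - r) by (intros; ring).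
    rewrite Hr, <- E.
    apply Rle_trans with (L * D * Rabs (clamp x0 d x - x0)).
    - apply abs_RInt_le_const_any.
      + intros t. apply (continuous_minus (V := R_NormedModule)); now apply cont2_along.
      + intros t. apply Rle_trans with (1 := Hl t (v t) (w t)).
        apply Rmult_le_compat_l; auto.
    - pose proof (clamp_dist x0 d x (Rlt_le _ _ Hd)).
      apply Rle_trans with (L * D * d); [|nra].
      apply Rmult_le_compat_l; [now apply Rmult_le_pos|assumption]. }
  assert (Hu1 : forall n x, Rabs (u (S n) x - u n x) <= B * d * (/ 2) ^ n).
  { induction n as [|n IH]; intros x.
    - unfold u; simpl. rewrite Rplus_minus_l, Rmult_1_r.
      apply Rle_trans with (B * Rabs (clamp x0 d x - x0)).
      + apply abs_RInt_le_const_any; [|auto].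
        apply cont2_along; [exact Hf|]. intros t; apply continuous_const.
      + apply Rmult_le_compat_l; [exact HB|]. apply clamp_dist; lra.
    - replace (B * d * (/ 2) ^ S n) with (B * d * (/ 2) ^ n / 2) by (simpl; field).
      apply (Hcontr (u (S n)) (u n)); [apply Hlip|apply Hlip|exact IH]. }
  assert (Hpow : forall n, 0 < (/ 2) ^ n) by (intros n; apply pow_lt; lra).
  assert (HBd : 0 <= B * d) by (apply Rmult_le_pos; lra).
  assert (Hu2 : forall n k x, Rabs (u (n + k)%nat x - u n x)
                  <= 2 * (B * d) * (/ 2) ^ n * (1 - (/ 2) ^ k)).
  { intros n k x. induction k as [|k IH].
    - rewrite Nat.add_0_r, Rminus_diag, Rabs_R0. simpl. lra.
    - rewrite Nat.add_succ_r. specialize (Hu1 (n + k)%nat x).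
      replace (u (S (n + k)) x - u n x)
        with ((u (S (n + k)) x - u (n + k)%nat x) + (u (n + k)%nat x - u n x)) by ring.
      apply Rle_trans with (1 := Rabs_triang _ _).
      rewrite pow_add in Hu1. simpl ((/ 2) ^ S k). lra. }
  assert (Hu3 : forall n m x, (n <= m)%nat ->
    Rabs (u m x - u n x) <= 2 * (B * d) * (/ 2) ^ n).
  { intros n m x Hnm. replace m with (n + (m - n))%nat by lia.
    apply Rle_trans with (1 := Hu2 n (m - n)%nat x).
    pose proof (Hpow n). pose proof (Hpow (m - n)%nat).
    rewrite <- (Rmult_1_r (2 * (B * d) * (/ 2) ^ n)) at 2.
    apply Rmult_le_compat_l; [|lra]. apply Rmult_le_pos; lra. }
  assert (Hsmall : forall C e, 0 <= C -> 0 < e -> exists N, C * (/ 2) ^ N < e).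
  { intros C e HC He. destruct (pow_lt_1_zero (/ 2)) with (y := e / (C + 1)) as [N HN].
    - rewrite Rabs_pos_eq; lra.
    - apply Rdiv_lt_0_compat; lra.
    - exists N. specialize (HN N (le_n N)). specialize (Hpow N).
      rewrite Rabs_pos_eq in HN by lra.
      apply (Rmult_lt_compat_l (C + 1)) in HN; [|lra].
      replace ((C + 1) * (e / (C + 1))) with e in HN by (field; lra). nra. }
  assert (Hex : forall x, ex_finite_lim_seq (fun n => u n x)).
  { intros x. apply ex_lim_seq_cauchy_corr. intros e.
    destruct (Hsmall (4 * (B * d)) e ltac:(lra) (cond_pos e)) as [N HN].
    exists N. intros n m Hn Hm.
    pose proof (Hu3 N n x Hn). pose proof (Hu3 N m x Hm).
    replace (u n x - u m x) with ((u n x - u N x) - (u m x - u N x)) by ring.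
    apply Rle_lt_trans with (1 := Rabs_triang _ _). rewrite Rabs_Ropp. lra. }
  set (v := fun x => real (Lim_seq (fun n => u n x))).
  assert (Hv : forall x n, Rabs (v x - u n x) <= 2 * (B * d) * (/ 2) ^ n).
  { intros x n.
    assert (H : is_lim_seq (fun m => Rabs (u m x - u n x)) (Rabs (v x - u n x))).
    { apply (is_lim_seq_abs _ (v x - u n x)).
      apply (is_lim_seq_minus' _ _ (v x) (u n x));
        [now apply Lim_seq_correct'|apply is_lim_seq_const]. }
    apply (is_lim_seq_le_loc (fun m => Rabs (u m x - u n x)) (fun _ => 2 * (B * d) * (/ 2) ^ n)
             (Rabs (v x - u n x)) (2 * (B * d) * (/ 2) ^ n)); [|exact H|apply is_lim_seq_const].
    exists n. intros m Hm. now apply Hu3. }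
  assert (Hz : forall a C, 0 <= C -> (forall n, a <= C * (/ 2) ^ n) -> a <= 0).
  { intros a C HC Ha. apply Rnot_lt_le. intros Hlt.
    destruct (Hsmall C a HC Hlt) as [N HN]. specialize (Ha N). lra. }
  (* The limit inherits the common Lipschitz constant of the iterates, and is therefore
     continuous. *)
  assert (Hvlip : forall s t, Rabs (v s - v t) <= B * Rabs (s - t)).
  { intros s t. apply Rminus_le, Hz with (4 * (B * d)); [lra|]. intros n.
    pose proof (Hv s n). pose proof (Hv t n) as H2. pose proof (proj2 (Hlip n) s t).
    rewrite <- Rabs_Ropp in H2.
    replace (v s - v t) with ((v s - u n s) + (u n s - u n t) + - (v t - u n t)) by ring.
    pose proof (Rabs_triang (v s - u n s + (u n s - u n t)) (- (v t - u n t))).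
    pose proof (Rabs_triang (v s - u n s) (u n s - u n t)). lra. }
  assert (Hvc : forall x, continuous v x) by (intros x; now apply lipschitz_continuous with B).
  exists v. split; [exact Hvc|]. intros x.
  apply Rminus_diag_uniq. apply Rabs_eq_0. apply Rle_antisym; [|apply Rabs_pos].
  apply Hz with (2 * (B * d)); [lra|]. intros n.
  (* Both the limit and its image under the Picard operator are within [O((/ 2) ^ n)] of the iterate
     [u (S n)], so they agree. *)
  pose proof (Hv x (S n)) as H1. simpl ((/ 2) ^ S n) in H1.
  pose proof (Hcontr (u n) v _ (proj1 (Hlip n)) Hvc
    (fun z => eq_ind_r (fun q => q <= _) (Hv z n) (Rabs_minus_sym (u n z) (v z))) x) as H2.
  change (y0 + RInt (fun t => f t (u n t)) x0 (clamp x0 d x)) with (u (S n) x) in H2.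
  set (w := y0 + RInt (fun t => f t (v t)) x0 (clamp x0 d x)) in *.
  replace (v x - w) with ((v x - u (S n) x) + (u (S n) x - w)) by ring.
  apply Rle_trans with (1 := Rabs_triang _ _). lra.
Qed.

Lemma continuity_2d_pt_bounded f x y : continuity_2d_pt f x y ->
  locally_2d (fun u v => Rabs (f u v) <= Rabs (f x y) + 1) x y.
Proof.
  intros Hf. destruct (Hf (mkposreal 1 Rlt_0_1)) as [d Hd]. simpl in Hd.
  exists d. intros u v Hu Hv. specialize (Hd u v Hu Hv).
  pose proof (Rabs_triang_inv (f u v) (f x y)). lra.
Qed.

(** Extend [f] from a small box to the plane by clamping both arguments; the bound on the derivative
    in the second variable becomes a global Lipschitz bound by the mean value theorem. The global
    solution stays in the box, where the clamping is invisible. The size [e] lets the caller confine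
    the solution to a region where further conditions hold. *)
Lemma local_ode (f : R -> R -> R) x0 y0 L e :
  0 < e ->
  locally_2d (fun x y => continuity_2d_pt f x y /\
     ex_derive (fun t => f x t) y /\ Rabs (Derive (fun t => f x t) y) <= L) x0 y0 ->
  exists (d : posreal) (u : R -> R), d <= e /\ u x0 = y0 /\
    forall x, Rabs (x - x0) < d ->
      Rabs (u x - y0) < e /\ is_derive u x (f x (u x)).
Proof.
  intros He [d1 H1].
  assert (Hc0 : continuity_2d_pt f x0 y0).
  { apply H1; rewrite Rminus_diag, Rabs_R0; apply cond_pos. }
  assert (HL : 0 <= L).
  { destruct (H1 x0 y0) as (_ & _ & H); try (rewrite Rminus_diag, Rabs_R0; apply cond_pos).
    apply Rle_trans with (2 := H), Rabs_pos. }
  destruct (continuity_2d_pt_bounded f x0 y0 Hc0) as [d2 H2].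
  set (B := Rabs (f x0 y0) + 1) in *.
  assert (HB : 0 < B) by (unfold B; pose proof (Rabs_pos (f x0 y0)); lra).
  set (r := Rmin (Rmin d1 d2) e / 2).
  assert (Hr : 0 < r /\ r < d1 /\ r < d2 /\ r < e).
  { pose proof (cond_pos d1). pose proof (cond_pos d2).
    assert (0 < Rmin (Rmin d1 d2) e) by (repeat apply Rmin_glb_lt; lra).
    pose proof (Rmin_l (Rmin d1 d2) e). pose proof (Rmin_r (Rmin d1 d2) e).
    pose proof (Rmin_l d1 d2). pose proof (Rmin_r d1 d2). unfold r. lra. }
  (* The three bounds keep the abscissa in the box, keep the graph in the box, and give the
     contraction factor 1/2; the [+ 1] covers [L = 0]. *)
  set (d := Rmin r (Rmin (r / B) (/ (2 * (L + 1))))).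
  assert (Hd : 0 < d /\ d <= r /\ B * d <= r /\ L * d <= 1 / 2).
  { assert (0 < r / B) by (apply Rdiv_lt_0_compat; lra).
    assert (0 < / (2 * (L + 1))) by (apply Rinv_0_lt_compat; lra).
    assert (Hd0 : 0 < d) by (unfold d; repeat apply Rmin_glb_lt; lra).
    assert (Hda : d <= r) by apply Rmin_l.
    assert (Hdb : d <= r / B) by (eapply Rle_trans; [apply Rmin_r|apply Rmin_l]).
    assert (Hdc : d <= / (2 * (L + 1))) by (eapply Rle_trans; [apply Rmin_r|apply Rmin_r]).
    repeat split; auto.
    - apply (Rmult_le_compat_l B) in Hdb; [|lra].
      replace (B * (r / B)) with r in Hdb by (field; lra). exact Hdb.
    - apply (Rmult_le_compat_l (L + 1)) in Hdc; [|lra].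
      replace ((L + 1) * / (2 * (L + 1))) with (1 / 2) in Hdc by (field; lra). nra. }
  set (g := fun x y => f (clamp x0 r x) (clamp y0 r y)).
  assert (Hcl : forall c x, Rabs (clamp c r x - c) <= r) by (intros; apply clamp_dist; lra).
  destruct (picard_global g x0 y0 B L d) as (u & Huc & Hu); try lra.
  - intros x y eps.
    destruct (H1 (clamp x0 r x) (clamp y0 r y)) as (Hc & _ & _);
      try (eapply Rle_lt_trans; [apply Hcl|lra]).
    destruct (Hc eps) as [a Ha]. exists a. intros s t Hs Ht.
    apply Ha; (eapply Rle_lt_trans; [apply clamp_lipschitz|assumption]).
  - intros x y. apply H2; (eapply Rle_lt_trans; [apply Hcl|lra]).
  - intros x y z. unfold g.
    apply Rle_trans with (L * Rabs (clamp y0 r y - clamp y0 r z)).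
    2:{ apply Rmult_le_compat_l; [exact HL|apply clamp_lipschitz]. }
    pose proof (Hcl x0 x). pose proof (Hcl y0 y). pose proof (Hcl y0 z).
    set (a := clamp x0 r x) in *. set (b := clamp y0 r y) in *. set (c := clamp y0 r z) in *.
    assert (Hin : forall t, Rmin c b <= t <= Rmax c b -> Rabs (t - y0) < d1).
    { intros t Ht. apply Rabs_le_between in H0, H3. apply Rabs_def1;
      revert Ht; unfold Rmin, Rmax; destruct (Rle_dec c b); lra. }
    destruct (MVT_gen (fun t => f a t) c b (Derive (fun t => f a t))) as (t & Ht & E).
    + intros t Ht. apply Derive_correct, H1; [lra|]. apply Hin; lra.
    + intros t Ht. apply derivable_continuous_pt. apply ex_derive_Reals_0.
      apply H1; [lra|]. now apply Hin.
    + rewrite E, Rabs_mult. apply Rmult_le_compat_r; [apply Rabs_pos|].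
      apply H1; [lra|]. now apply Hin.
  - exists (mkposreal d (proj1 Hd)), u. simpl.
    assert (Hgc : forall t, continuous (fun s => g s (u s)) t).
    { apply cont2_along; [|exact Huc]. intros x y eps.
      destruct (H1 (clamp x0 r x) (clamp y0 r y)) as (Hc & _ & _);
        try (eapply Rle_lt_trans; [apply Hcl|lra]).
      destruct (Hc eps) as [a Ha]. exists a. intros s t Hs Ht.
      apply Ha; (eapply Rle_lt_trans; [apply clamp_lipschitz|assumption]). }
    assert (Hur : forall x, Rabs (u x - y0) <= r).
    { intros x. rewrite Hu.
      rewrite Rplus_minus_l.
      apply Rle_trans with (B * Rabs (clamp x0 d x - x0)).
      - apply abs_RInt_le_const_any; [exact Hgc|].
        intros t. apply H2; (eapply Rle_lt_trans; [apply Hcl|lra]).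
      - pose proof (clamp_dist x0 d x). nra. }
    split; [lra|split].
    + rewrite Hu, clamp_id by (rewrite Rminus_diag, Rabs_R0; lra).
      rewrite RInt_point. apply Rplus_0_r.
    + intros x Hx. split; [apply Rle_lt_trans with (1 := Hur x); lra|].
      assert (Hg : g x (u x) = f x (u x)).
      { unfold g. rewrite !clamp_id; [reflexivity|apply Hur|lra]. }
      rewrite <- Hg.
      apply is_derive_ext_loc with (fun z => y0 + RInt (fun t => g t (u t)) x0 z).
      * assert (Hp : 0 < d - Rabs (x - x0)) by lra.
        exists (mkposreal _ Hp). intros z Hz.
        change (Rabs (z - x) < d - Rabs (x - x0)) in Hz.
        rewrite (Hu z), clamp_id; [reflexivity|].
        replace (z - x0) with ((z - x) + (x - x0)) by ring.
        apply Rle_trans with (1 := Rabs_triang _ _). lra.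
      * rewrite <- (Rplus_0_l (g x (u x))).
        apply (is_derive_plus (V := R_NormedModule) (fun _ => y0));
          [apply (is_derive_const (V := R_NormedModule))|].
        apply (is_derive_RInt (fun t => g t (u t)) (fun b => RInt (fun t => g t (u t)) x0 b) x0);
          [|apply Hgc].
        apply filter_forall. intros b.
        apply (RInt_correct (V := R_CompleteNormedModule)).
        apply (ex_RInt_continuous (V := R_CompleteNormedModule)). auto.
Qed.

(** * Functions constant on the leaves *)

Lemma chain_rule_2d f (p q : R -> R) t dp dq : smooth f ->
  is_derive p t dp -> is_derive q t dq ->
  is_derive (fun s => f (p s) (q s)) t
    (partial ax f (p t) (q t) * dp + partial ay f (p t) (q t) * dq).
Proof.
  intros Hf Hp Hq. apply is_derive_Reals, derivable_pt_lim_comp_2d;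
    try now apply is_derive_Reals.
  apply filterdiff_differentiable_pt_lim.
  apply (is_derive_filterdiff f (p t) (q t) (partial ax f)).
  - apply filter_forall. intros [u v]. apply Derive_correct.
    exact (proj1 (smooth_diff1 f Hf u v)).
  - apply Derive_correct. exact (proj2 (smooth_diff1 f Hf (p t) (q t))).
  - apply continuity_2d_pt_filterlim.
    apply (smooth_cont2 _ (smooth_partial ax f Hf)).
Qed.

(** The factor may be zero: curves tangent to [L] may stop and turn back, which the sine
    reparametrization of local curves exploits. *)
Lemma line_field_scale L x y (w : vec) c :
  foliation L -> L x y w -> L x y (fun i => c * w i).
Proof.
  intros HL Hw. destruct (foliation_smooth L HL x y) as (V & d & HV).
  destruct (HV x y) as [_ [_ HV']]; try (rewrite Rminus_diag, Rabs_R0; apply cond_pos).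
  apply HV' in Hw. destruct Hw as [a Ha]. apply HV'. exists (c * a).
  intros i. rewrite Ha. ring.
Qed.

(* The leaf relation wants curves defined on all of [R]: run along the local
   curve as [s |-> c (tau * sin (s * PI / 2))]. *)
Lemma constant_along_tangent_curve L f (c : axis -> R -> R) (d : posreal) :
  foliation L -> constant_on_leaves L f ->
  (forall t, Rabs t < d -> (forall i, ex_derive (c i) t) /\
     L (c ax t) (c ay t) (fun i => Derive (c i) t)) ->
  forall t, Rabs t < d -> f (c ax t) (c ay t) = f (c ax 0) (c ay 0).
Proof.
  intros HL Hf Hc tau Ht. apply Hf.
  assert (Hs : forall s, Rabs (tau * sin (s * (PI / 2))) < d).
  { intros s. rewrite Rabs_mult. apply Rle_lt_trans with (2 := Ht).
    rewrite <- (Rmult_1_r (Rabs tau)) at 2. apply Rmult_le_compat_l; [apply Rabs_pos|].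
    apply Rabs_le, SIN_bound. }
  assert (Hd : forall i s, is_derive (fun s => c i (tau * sin (s * (PI / 2)))) s
    (tau * cos (s * (PI / 2)) * (PI / 2) * Derive (c i) (tau * sin (s * (PI / 2))))).
  { intros i s.
    apply (is_derive_comp (c i) (fun s => tau * sin (s * (PI / 2)))).
    - apply Derive_correct. apply (proj1 (Hc _ (Hs s))).
    - auto_derive; [exact I|]. unfold Rdiv; ring. }
  exists (fun i s => c i (tau * sin (s * (PI / 2)))).
  split.
  - intros s. split; [intros i; eexists; apply Hd|].
    replace (fun i => Derive (fun s => c i (tau * sin (s * (PI / 2)))) s)
      with (fun i => (tau * cos (s * (PI / 2)) * (PI / 2))
                     * Derive (c i) (tau * sin (s * (PI / 2)))).
    + apply (line_field_scale L _ _ _ _ HL), (proj2 (Hc _ (Hs s))).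
    + extensionality i. symmetry. apply is_derive_unique, Hd.
  - rewrite Rmult_0_l, Rmult_1_l, sin_0, sin_PI2, Rmult_0_r, Rmult_1_r. auto.
Qed.

Lemma derivative_along_tangent_curve L f (c : axis -> R -> R) (d : posreal) :
  foliation L -> constant_on_leaves L f -> smooth f ->
  (forall t, Rabs t < d -> (forall i, ex_derive (c i) t) /\
     L (c ax t) (c ay t) (fun i => Derive (c i) t)) ->
  partial ax f (c ax 0) (c ay 0) * Derive (c ax) 0
  + partial ay f (c ax 0) (c ay 0) * Derive (c ay) 0 = 0.
Proof.
  intros HL Hf Hs Hc.
  assert (H0 : Rabs 0 < d) by (rewrite Rabs_R0; apply cond_pos).
  assert (D := chain_rule_2d f (c ax) (c ay) 0 _ _ Hs
    (Derive_correct _ _ (proj1 (Hc 0 H0) ax)) (Derive_correct _ _ (proj1 (Hc 0 H0) ay))).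
  apply is_derive_unique in D. rewrite <- D.
  transitivity (Derive (fun _ => f (c ax 0) (c ay 0)) 0);
    [|exact (Derive_const (f (c ax 0) (c ay 0)) 0)].
  apply Derive_ext_loc. exists d. intros t Ht.
  change (Rabs (t - 0) < d) in Ht. rewrite Rminus_0_r in Ht.
  exact (constant_along_tangent_curve L f c d HL Hf Hc t Ht).
Qed.

(** Exchanges the coordinates, so that leaves that are graphs over the second axis come from the
    same existence theorem as graphs over the first. *)
Definition swap (f : scalar_field) : scalar_field := fun x y => f y x.

Lemma locally_2d_swap (P : R -> R -> Prop) x y :
  locally_2d P x y -> locally_2d (fun u v => P v u) y x.
Proof. intros [d H]. exists d. auto. Qed.

Lemma continuity_2d_pt_swap f x y :
  continuity_2d_pt f x y -> continuity_2d_pt (swap f) y x.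
Proof. intros H e. apply (locally_2d_swap _ _ _ (H e)). Qed.

(** Just the regularity that the slope estimate needs. It follows from smoothness for [f] and for
    [swap f] alike, without a proof that [swap] preserves smoothness. *)
Definition C1_in_second (f : scalar_field) (x y : R) : Prop :=
  continuity_2d_pt f x y /\ ex_derive (fun t => f x t) y /\
  continuity_2d_pt (partial ay f) x y.

Lemma C1_in_second_smooth_at f x y : smooth_at f x y -> C1_in_second f x y.
Proof. intros H. repeat split; apply (H 1%nat). Qed.

Lemma C1_in_second_swap_smooth_at f x y : smooth_at f x y -> C1_in_second (swap f) y x.
Proof.
  intros H. split; [apply continuity_2d_pt_swap, (H 1%nat)|split; [apply (H 1%nat)|]].
  apply (continuity_2d_pt_swap (partial ax f)), (H 1%nat).
Qed.

(** The quotient is the slope of a direction field. Where [Q] is nonzero its derivative is the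
    expression [D], which is continuous at the base point and hence bounded near it. *)
Lemma quotient_slope_bound (P Q : scalar_field) x0 y0 :
  Q x0 y0 <> 0 ->
  locally_2d (fun x y => C1_in_second P x y /\ C1_in_second Q x y) x0 y0 ->
  exists M, locally_2d (fun x y => continuity_2d_pt (fun u v => P u v / Q u v) x y /\
    ex_derive (fun t => P x t / Q x t) y /\
    Rabs (Derive (fun t => P x t / Q x t) y) <= M) x0 y0.
Proof.
  intros HQ0 Hloc.
  destruct (locally_2d_singleton _ _ _ Hloc) as [(P0 & _ & P2) (Q0 & _ & Q2)].
  set (D := fun x y => (partial ay P x y * Q x y - P x y * partial ay Q x y)
                       * / (Q x y * Q x y)).
  assert (HD : continuity_2d_pt D x0 y0).
  { apply continuity_2d_pt_mult.
    - apply continuity_2d_pt_minus; now apply continuity_2d_pt_mult.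
    - apply continuity_2d_pt_inv; [|now apply Rmult_integral_contrapositive].
      now apply continuity_2d_pt_mult. }
  exists (Rabs (D x0 y0) + 1).
  pose proof (locally_2d_and _ _ _ _ Hloc (locally_2d_and _ _ _ _
    (continuity_2d_pt_bounded D x0 y0 HD) (continuity_2d_pt_neq_0 Q x0 y0 Q0 HQ0))) as H.
  revert H. apply locally_2d_impl, locally_2d_forall.
  intros x y (((P3 & P4 & _) & (Q3 & Q4 & _)) & HB & HQ).
  split; [|split].
  - apply continuity_2d_pt_mult; [exact P3|]. now apply continuity_2d_pt_inv.
  - now apply (ex_derive_div (fun t => P x t) (fun t => Q x t)).
  - rewrite (Derive_div (fun t => P x t) (fun t => Q x t)) by assumption.
    replace (_ / _) with (D x y); [exact HB|].
    unfold D, partial. field. exact HQ.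
Qed.

(** A local spanning field [V] has a nonzero component at the point. Over that axis an integral
    curve is a graph whose slope is the quotient of the components; [v] is its velocity, and [f] is
    constant along it. *)
Lemma leaf_direction L f x0 y0 :
  foliation L -> constant_on_leaves L f -> smooth f ->
  exists v : vec, (exists i, v i <> 0) /\ L x0 y0 v /\
    partial ax f x0 y0 * v ax + partial ay f x0 y0 * v ay = 0.
Proof.
  intros HL Hf Hs. destruct (foliation_smooth L HL x0 y0) as (V & HV).
  pose proof (locally_2d_singleton _ _ _ HV) as [_ [[i Hi] _]].
  assert (HVs : locally_2d (fun x y => forall i, smooth_at (V i) x y) x0 y0).
  { revert HV. apply locally_2d_impl, locally_2d_forall. intros u v H. apply H. }
  destruct HV as [e HV].
  enough (Hc : exists (c : axis -> R -> R) (d : posreal),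
    (forall t, Rabs t < d -> (forall i, ex_derive (c i) t) /\
       L (c ax t) (c ay t) (fun i => Derive (c i) t)) /\
    c ax 0 = x0 /\ c ay 0 = y0 /\ exists i, Derive (c i) 0 <> 0).
  { destruct Hc as (c & d & Hc & <- & <- & Hn).
    exists (fun i => Derive (c i) 0). split; [exact Hn|split].
    - apply Hc. rewrite Rabs_R0. apply cond_pos.
    - now apply (derivative_along_tangent_curve L f c d). }
  destruct i.
  - destruct (quotient_slope_bound (V ay) (V ax) x0 y0 Hi) as [M HM].
    { revert HVs. apply locally_2d_impl, locally_2d_forall.
      intros u v H. split; apply C1_in_second_smooth_at, H. }
    pose proof (locally_2d_and _ _ _ _ HM (continuity_2d_pt_neq_0 (V ax) x0 y0
      (proj1 (locally_2d_singleton _ _ _ HVs ax 0%nat)) Hi)) as [e' He'].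
    destruct (local_ode (fun x y => V ay x y / V ax x y) x0 y0 M (Rmin e e'))
      as (d & u & Hde & Hu0 & Hu).
    { apply Rmin_glb_lt; apply cond_pos. }
    { exists e'. intros s t H1 H2. now apply He'. }
    pose proof (Rmin_l e e'). pose proof (Rmin_r e e').
    assert (Hd : forall t, Rabs t < d ->
      is_derive (fun s => u (x0 + s)) t (V ay (x0 + t) (u (x0 + t)) / V ax (x0 + t) (u (x0 + t)))).
    { intros t Ht. rewrite <- (Rmult_1_l (_ / _)).
      apply (is_derive_comp u (fun s => x0 + s)).
      - apply Hu. now rewrite Rplus_minus_l.
      - auto_derive; [exact I|ring]. }
    assert (Hd1 : forall t, is_derive (fun s => x0 + s) t 1).
    { intros t. auto_derive; [exact I|ring]. }
    exists (fun i s => match i with ax => x0 + s | ay => u (x0 + s) end), d.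
    split; [|split; [apply Rplus_0_r|split; [rewrite Rplus_0_r; exact Hu0|]]].
    + intros t Ht. split; [intros []; eexists; [apply Hd1|now apply Hd]|].
      destruct (Hu (x0 + t)) as [Hut _]; [now rewrite Rplus_minus_l|].
      assert (Hq : V ax (x0 + t) (u (x0 + t)) <> 0).
      { apply He'; [rewrite Rplus_minus_l|]; lra. }
      destruct (HV (x0 + t) (u (x0 + t))) as [_ [_ HL']];
        [rewrite Rplus_minus_l; lra|lra|].
      (* The graph has velocity [(1, V ay / V ax)], that is, [V / V ax]. *)
      apply HL'. exists (/ V ax (x0 + t) (u (x0 + t))).
      intros []; apply is_derive_unique.
      * rewrite Rinv_l by exact Hq. apply Hd1.
      * rewrite Rmult_comm. now apply Hd.
    + exists ax. intros E. apply R1_neq_R0. rewrite <- E. symmetry. apply is_derive_unique, Hd1.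
  - destruct (quotient_slope_bound (swap (V ax)) (swap (V ay)) y0 x0 Hi) as [M HM].
    { generalize (locally_2d_swap _ _ _ HVs). apply locally_2d_impl, locally_2d_forall.
      intros u v H. split; apply C1_in_second_swap_smooth_at, H. }
    pose proof (locally_2d_and _ _ _ _ HM (locally_2d_swap _ _ _
      (continuity_2d_pt_neq_0 (V ay) x0 y0
        (proj1 (locally_2d_singleton _ _ _ HVs ay 0%nat)) Hi))) as [e' He'].
    destruct (local_ode (fun x y => swap (V ax) x y / swap (V ay) x y) y0 x0 M (Rmin e e'))
      as (d & u & Hde & Hu0 & Hu).
    { apply Rmin_glb_lt; apply cond_pos. }
    { exists e'. intros s t H1 H2. now apply He'. }
    pose proof (Rmin_l e e'). pose proof (Rmin_r e e').
    assert (Hd : forall t, Rabs t < d ->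
      is_derive (fun s => u (y0 + s)) t (V ax (u (y0 + t)) (y0 + t) / V ay (u (y0 + t)) (y0 + t))).
    { intros t Ht. rewrite <- (Rmult_1_l (_ / _)).
      apply (is_derive_comp u (fun s => y0 + s)).
      - apply Hu. now rewrite Rplus_minus_l.
      - auto_derive; [exact I|ring]. }
    assert (Hd1 : forall t, is_derive (fun s => y0 + s) t 1).
    { intros t. auto_derive; [exact I|ring]. }
    exists (fun i s => match i with ay => y0 + s | ax => u (y0 + s) end), d.
    split; [|split; [rewrite Rplus_0_r; exact Hu0|split; [apply Rplus_0_r|]]].
    + intros t Ht. split; [intros []; eexists; [now apply Hd|apply Hd1]|].
      destruct (Hu (y0 + t)) as [Hut _]; [now rewrite Rplus_minus_l|].
      assert (Hq : V ay (u (y0 + t)) (y0 + t) <> 0).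
      { apply He'; [rewrite Rplus_minus_l|]; lra. }
      destruct (HV (u (y0 + t)) (y0 + t)) as [_ [_ HL']];
        [lra|rewrite Rplus_minus_l; lra|].
      apply HL'. exists (/ V ay (u (y0 + t)) (y0 + t)).
      intros []; apply is_derive_unique.
      * rewrite Rmult_comm. now apply Hd.
      * rewrite Rinv_l by exact Hq. apply Hd1.
    + exists ay. intros E. apply R1_neq_R0. rewrite <- E. symmetry. apply is_derive_unique, Hd1.
Qed.

(** * Functions with null gradient on a Lorentzian surface *)

Ltac smooth_step :=
  match goal with
  | H : smooth ?f |- smooth ?f => exact H
  | |- smooth (fun x y => ?f x y) => first [assumption | change (smooth f); assumption]
  | |- smooth (fun x y => partial ?i ?f x y) => apply (smooth_partial i f)
  | |- smooth (partial ?i ?f) => apply (smooth_partial i f)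
  | |- smooth (fun x y => _ + _) => apply smooth_plus
  | |- smooth (fun x y => _ - _) => apply smooth_minus
  | |- smooth (fun x y => _ * _) => apply smooth_mult
  | |- smooth (fun x y => - _) => apply smooth_opp
  | |- smooth (fun x y => _ / _) => apply smooth_div
  | |- smooth (fun x y => atan _) => apply smooth_atan
  | |- smooth (fun _ _ => ?c) => apply (smooth_const c)
  end.
Ltac solve_smooth := repeat smooth_step; auto.

Ltac expand_partial :=
  repeat first
    [ rewrite partial_plus by solve_smooth
    | rewrite partial_minus by solve_smooth
    | rewrite partial_mult by solve_smooth
    | rewrite partial_opp
    | rewrite partial_const ].

Definition delta (i j : axis) : R :=
  match i, j with ax, ax | ay, ay => 1 | _, _ => 0 end.

(* [A k i j] is the Christoffel symbol [A^k_ij] of the Levi-Civita connection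
   of [h], and [K] its curvature, characterized by
   [R(d_x, d_y) d_k = K (h(d_y, d_k) d_x - h(d_x, d_k) d_y)]. *)
Record lorentzian_surface (h : tensor2_field) (A : axis -> tensor2_field)
    (K : scalar_field) : Prop := {
  surface_smooth_h : forall i j, smooth (h i j);
  surface_smooth_A : forall k i j, smooth (A k i j);
  surface_smooth_K : smooth K;
  surface_periodic_h : forall i j, periodic (h i j);
  surface_periodic_A : forall k i j, periodic (A k i j);
  surface_periodic_K : periodic K;
  surface_sym_h : h ay ax = h ax ay;
  surface_sym_A : forall k, A k ay ax = A k ax ay;
  surface_det : forall x y, metric_det h x y < 0;
  surface_compatible : forall i j k x y, partial i (h j k) x y =
    sum_axis (fun l => h l k x y * A l i j x y + h j l x y * A l i k x y);
  surface_curvature : forall l k x y,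
    partial ax (A l ay k) x y - partial ay (A l ax k) x y
    + sum_axis (fun m => A l ax m x y * A m ay k x y - A l ay m x y * A m ax k x y)
    = K x y * (h ay k x y * delta l ax - h ax k x y * delta l ay)
}.

(** The covariant Hessian [nabla df]. *)
Definition hess (A : axis -> tensor2_field) (f : scalar_field) (i j : axis) :
    scalar_field :=
  fun x y => partial i (partial j f) x y
             - (A ax i j x y * partial ax f x y + A ay i j x y * partial ay f x y).

(* [metric_det h] times the gradient, so that no division is needed. *)
Definition cograd (h : tensor2_field) (f : scalar_field) (i : axis) : scalar_field :=
  match i with
  | ax => fun x y => h ay ay x y * partial ax f x y - h ax ay x y * partial ay f x y
  | ay => fun x y => h ax ax x y * partial ay f x y - h ax ay x y * partial ax f x y
  end.

Definition grad_null (h : tensor2_field) (f : scalar_field) : Prop :=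
  forall x y, cograd h f ax x y * partial ax f x y
              + cograd h f ay x y * partial ay f x y = 0.

(** The Euclidean norm, because the norm defined by [h] vanishes identically on a null gradient,
    whereas this one detects the critical points. *)
Definition gradsq (f : scalar_field) : scalar_field :=
  fun x y => partial ax f x y * partial ax f x y + partial ay f x y * partial ay f x y.

Lemma hess_sym h A K f x y : lorentzian_surface h A K -> smooth f ->
  hess A f ay ax x y = hess A f ax ay x y.
Proof.
  intros S Hf. unfold hess. rewrite !(surface_sym_A _ _ _ S), partial_comm by exact Hf.
  reflexivity.
Qed.

Ltac surface_hyps S :=
  pose proof (surface_smooth_h _ _ _ S);
  pose proof (surface_smooth_A _ _ _ S);
  pose proof (surface_smooth_K _ _ _ S).

(** Differentiate [|grad f|^2 = 0] with a metric connection. Since [cograd] carries the factor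
    [metric_det h], a derivative of the determinant also appears; it multiplies the null equation
    and drops out ([T] below). *)
Lemma hess_cograd h A K f k x y : lorentzian_surface h A K -> smooth f ->
  grad_null h f ->
  cograd h f ax x y * hess A f ax k x y + cograd h f ay x y * hess A f ay k x y = 0.
Proof.
  intros S Hf Hn. surface_hyps S.
  assert (D : partial k (fun x y => cograd h f ax x y * partial ax f x y
              + cograd h f ay x y * partial ay f x y) x y = 0).
  { rewrite <- (partial_const k 0 x y). f_equal.
    extensionality u; extensionality v. apply Hn. }
  specialize (Hn x y).
  assert (T : (A ax k ax x y + A ay k ay x y) *
     (cograd h f ax x y * partial ax f x y + cograd h f ay x y * partial ay f x y) = 0).
  { rewrite Hn; ring. }
  unfold cograd, hess in *.
  revert D. expand_partial. rewrite !(surface_compatible _ _ _ S). unfold sum_axis.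
  rewrite ?(surface_sym_h _ _ _ S).
  destruct k; rewrite ?(surface_sym_A _ _ _ S) in *;
    rewrite ?(partial_comm f) by exact Hf; intros D; lra.
Qed.

Lemma cograd_smooth h A K f i : lorentzian_surface h A K -> smooth f ->
  smooth (cograd h f i).
Proof. intros S Hf. surface_hyps S. destruct i; unfold cograd; solve_smooth. Qed.

Lemma hess_smooth h A K f i j : lorentzian_surface h A K -> smooth f ->
  smooth (hess A f i j).
Proof. intros S Hf. surface_hyps S. unfold hess; solve_smooth. Qed.

Lemma gradsq_smooth f : smooth f -> smooth (gradsq f).
Proof. intros Hf. unfold gradsq; solve_smooth. Qed.

(** The raised vector annihilates both [(p, q)] and [(m, n)], so these are parallel unless it
    vanishes, and by nondegeneracy it vanishes only with [(p, q)]. The number [nu] is its Euclidean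
    cross product with [(p, q)]; as the two are also orthogonal, [nu = 0] forces one of them to be
    zero. *)
Lemma null_kernel_parallel (E F G p q m n : R) : E * G - F * F < 0 ->
  (G * p - F * q) * p + (E * q - F * p) * q = 0 ->
  (G * p - F * q) * m + (E * q - F * p) * n = 0 -> q * m = p * n.
Proof.
  intros Hd Hn Hm. set (nu := (G * p - F * q) * q - (E * q - F * p) * p).
  assert (H : nu * (q * m - p * n) = 0).
  { transitivity ((p * p + q * q) * ((G * p - F * q) * m + (E * q - F * p) * n)
      - (p * m + q * n) * ((G * p - F * q) * p + (E * q - F * p) * q)).
    - unfold nu; ring.
    - rewrite Hm, Hn; ring. }
  apply Rmult_integral in H. destruct H as [H|H]; [|lra].
  assert (Hp : (p * p + q * q) * (E * G - F * F) * p = 0).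
  { transitivity (E * (q * nu + p * ((G * p - F * q) * p + (E * q - F * p) * q))
      + F * (- p * nu + q * ((G * p - F * q) * p + (E * q - F * p) * q))).
    - unfold nu; ring.
    - rewrite H, Hn; ring. }
  assert (Hq : (p * p + q * q) * (E * G - F * F) * q = 0).
  { transitivity (F * (q * nu + p * ((G * p - F * q) * p + (E * q - F * p) * q))
      + G * (- p * nu + q * ((G * p - F * q) * p + (E * q - F * p) * q))).
    - unfold nu; ring.
    - rewrite H, Hn; ring. }
  assert (HN : (E * G - F * F) * ((p * p + q * q) * (p * p + q * q)) = 0).
  { apply (f_equal (Rmult p)) in Hp. apply (f_equal (Rmult q)) in Hq. lra. }
  apply Rmult_integral in HN. destruct HN as [HN|HN]; [lra|].
  apply Rmult_integral in HN.
  assert (p = 0 /\ q = 0) as [-> ->] by (split; nra). ring.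
Qed.

Lemma hess_parallel h A K f k x y : lorentzian_surface h A K -> smooth f ->
  grad_null h f ->
  partial ay f x y * hess A f ax k x y = partial ax f x y * hess A f ay k x y.
Proof.
  intros S Hf Hn.
  pose proof (surface_det _ _ _ S x y) as Hd. unfold metric_det in Hd.
  rewrite (surface_sym_h _ _ _ S) in Hd.
  exact (null_kernel_parallel _ _ _ _ _ _ _ Hd (Hn x y)
           (hess_cograd h A K f k x y S Hf Hn)).
Qed.

(** The trace with respect to [h] is zero when the gradient is null; the Euclidean one recovers the
    factor of [df (x) df], whose Euclidean trace is [gradsq f]. *)
Definition hess_tr (A : axis -> tensor2_field) (f : scalar_field) : scalar_field :=
  fun x y => hess A f ax ax x y + hess A f ay ay x y.

(** A symmetric matrix with all rows parallel to [df] is a multiple of [df (x) df], and the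
    Euclidean trace identifies the multiple. *)
Lemma hess_rank_one h A K f i j x y : lorentzian_surface h A K -> smooth f ->
  grad_null h f ->
  gradsq f x y * hess A f i j x y = hess_tr A f x y * (partial i f x y * partial j f x y).
Proof.
  intros S Hf Hn. pose proof (hess_sym h A K f x y S Hf) as Hs.
  pose proof (hess_parallel h A K f ax x y S Hf Hn) as H1.
  pose proof (hess_parallel h A K f ay x y S Hf Hn) as H2.
  unfold gradsq, hess_tr. rewrite Hs in *.
  set (p := partial ax f x y) in *. set (q := partial ay f x y) in *.
  set (a := hess A f ax ax x y) in *. set (b := hess A f ax ay x y) in *.
  set (c := hess A f ay ay x y) in *.
  pose proof (f_equal (Rmult p) H1). pose proof (f_equal (Rmult q) H1).
  pose proof (f_equal (Rmult p) H2). pose proof (f_equal (Rmult q) H2).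
  destruct i, j; rewrite ?Hs; fold a b c p q; lra.
Qed.

(** The hypotheses say that the matrix with rows [(a, b)] and [(c, d)] squares to zero. *)
Lemma nilpotent_trace_zero (a b c d : R) :
  a * a + b * c = 0 -> a * b + b * d = 0 -> c * a + d * c = 0 -> c * b + d * d = 0 ->
  a + d = 0.
Proof.
  intros H1 H2 H3 H4.
  destruct (Req_dec (a + d) 0) as [E|E]; [exact E|].
  assert (b = 0) by (apply Rmult_eq_reg_r with (a + d); lra). subst b.
  assert (a = 0) by nra. assert (d = 0) by nra. lra.
Qed.

(* The Laplacian vanishes: off the critical points the Hessian is a multiple of
   the square of a null covector; at a critical point differentiating
   [Hess(grad f, .) = 0] makes the Hessian nilpotent as an endomorphism. *)
Lemma laplacian_zero h A K f x y : lorentzian_surface h A K -> smooth f ->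
  grad_null h f ->
  h ay ay x y * hess A f ax ax x y - 2 * h ax ay x y * hess A f ax ay x y
  + h ax ax x y * hess A f ay ay x y = 0.
Proof.
  intros S Hf Hn. pose proof (hess_sym h A K f x y S Hf) as Hs.
  destruct (Req_dec (gradsq f x y) 0) as [Hz|Hz].
  - assert (Hpq : partial ax f x y = 0 /\ partial ay f x y = 0).
    { unfold gradsq in Hz. split; nra. }
    destruct Hpq as [Hp Hq].
    assert (HC : forall k, smooth (hess A f k k) /\ smooth (cograd h f k)).
    { intros k. split; [now apply hess_smooth with h K|now apply cograd_smooth with A K]. }
    (* Where [df = 0], [cograd] vanishes and its derivative is the Hessian contracted with the
       cofactor matrix of [h], so differentiating [hess_cograd] leaves a quadratic identity in the
       Hessian. *)
    assert (D : forall l k,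
      (h ay ay x y * hess A f l ax x y - h ax ay x y * hess A f l ay x y) * hess A f ax k x y
      + (h ax ax x y * hess A f l ay x y - h ax ay x y * hess A f l ax x y)
        * hess A f ay k x y = 0).
    { intros l k.
      assert (D : partial l (fun x y => cograd h f ax x y * hess A f ax k x y
              + cograd h f ay x y * hess A f ay k x y) x y = 0).
      { rewrite <- (partial_const l 0 x y). f_equal.
        extensionality u; extensionality v. now apply hess_cograd with K. }
      revert D.
      pose proof (fun i => cograd_smooth h A K f i S Hf).
      pose proof (fun i j => hess_smooth h A K f i j S Hf).
      rewrite partial_plus by (apply smooth_mult; auto).
      rewrite !partial_mult by auto.
      assert (W : forall i, cograd h f i x y = 0).
      { intros []; unfold cograd; rewrite Hp, Hq; ring. }
      assert (DW : forall i, partial l (cograd h f i) x y =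
        match i with
        | ax => h ay ay x y * hess A f l ax x y - h ax ay x y * hess A f l ay x y
        | ay => h ax ax x y * hess A f l ay x y - h ax ay x y * hess A f l ax x y
        end).
      { surface_hyps S.
        intros []; unfold cograd, hess; expand_partial; rewrite Hp, Hq; ring. }
      rewrite !W, !DW. intros D. lra. }
    pose proof (D ax ax) as D1. pose proof (D ax ay) as D2.
    pose proof (D ay ax) as D3. pose proof (D ay ay) as D4.
    rewrite Hs in *.
    set (a := hess A f ax ax x y) in *. set (b := hess A f ax ay x y) in *.
    set (c := hess A f ay ay x y) in *.
    set (E := h ax ax x y) in *. set (F := h ax ay x y) in *. set (G := h ay ay x y) in *.
    (* [D] reads [Hess cof(h) Hess = 0]. One more multiplication by [cof(h)] makes it say that
       [cof(h) Hess] squares to zero; the trace of that matrix is the Laplacian up to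
       [metric_det h]. *)
    pose proof (f_equal (Rmult E) D1). pose proof (f_equal (Rmult F) D1).
    pose proof (f_equal (Rmult G) D1). pose proof (f_equal (Rmult E) D2).
    pose proof (f_equal (Rmult F) D2). pose proof (f_equal (Rmult G) D2).
    pose proof (f_equal (Rmult E) D3). pose proof (f_equal (Rmult F) D3).
    pose proof (f_equal (Rmult G) D3). pose proof (f_equal (Rmult E) D4).
    pose proof (f_equal (Rmult F) D4). pose proof (f_equal (Rmult G) D4).
    replace (G * a - 2 * F * b + E * c) with ((G * a - F * b) + (E * c - F * b)) by ring.
    apply (nilpotent_trace_zero _ (G * b - F * c) (E * b - F * a)); lra.
  - apply Rmult_eq_reg_l with (2 := Hz). rewrite Rmult_0_r.
    pose proof (hess_rank_one h A K f ax ax x y S Hf Hn) as H1.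
    pose proof (hess_rank_one h A K f ax ay x y S Hf Hn) as H2.
    pose proof (hess_rank_one h A K f ay ay x y S Hf Hn) as H3.
    specialize (Hn x y). unfold cograd in Hn.
    transitivity (h ay ay x y * (gradsq f x y * hess A f ax ax x y)
      - 2 * h ax ay x y * (gradsq f x y * hess A f ax ay x y)
      + h ax ax x y * (gradsq f x y * hess A f ay ay x y)); [ring|].
    rewrite H1, H2, H3.
    apply (f_equal (Rmult (hess_tr A f x y))) in Hn. lra.
Qed.

(* Ricci identity for [df]. *)
Lemma hess_codazzi h A K f j x y : lorentzian_surface h A K -> smooth f ->
  partial ax (hess A f ay j) x y - partial ay (hess A f ax j) x y
  = sum_axis (fun l => A l ax j x y * hess A f ay l x y - A l ay j x y * hess A f ax l x y)
    - K x y * (h ay j x y * partial ax f x y - h ax j x y * partial ay f x y).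
Proof.
  intros S Hf. surface_hyps S.
  pose proof (surface_curvature _ _ _ S ax j x y) as R1.
  pose proof (surface_curvature _ _ _ S ay j x y) as R2.
  apply (f_equal (Rmult (partial ax f x y))) in R1.
  apply (f_equal (Rmult (partial ay f x y))) in R2.
  unfold hess. expand_partial. unfold sum_axis, delta in *.
  rewrite !(surface_sym_A _ _ _ S) in *.
  rewrite (partial_comm (partial j f)) by solve_smooth.
  destruct j; rewrite ?(surface_sym_A _ _ _ S) in *;
    rewrite ?(partial_comm f) by exact Hf; lra.
Qed.

Lemma hess_tr_smooth h A K f : lorentzian_surface h A K -> smooth f ->
  smooth (hess_tr A f).
Proof.
  intros S Hf. unfold hess_tr. apply smooth_plus; now apply hess_smooth with h K.
Qed.

Definition along (h : tensor2_field) (f g : scalar_field) : scalar_field :=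
  fun x y => cograd h f ax x y * partial ax g x y + cograd h f ay x y * partial ay g x y.

(** The Ricci identity for [Hess = b df (x) df] with [b = S / N], times [N ^ 2]. Derivatives falling
    on [df] produce the Hessian again, hence a multiple of [df ^ df = 0]; only [(db ^ df) (x) df]
    and the curvature term remain. *)
Lemma hess_tr_curl h A K f j x y : lorentzian_surface h A K -> smooth f ->
  grad_null h f ->
  gradsq f x y * partial j f x y
    * (partial ax (hess_tr A f) x y * partial ay f x y
       - partial ay (hess_tr A f) x y * partial ax f x y)
  = hess_tr A f x y * partial j f x y
    * (partial ax (gradsq f) x y * partial ay f x y
       - partial ay (gradsq f) x y * partial ax f x y)
    - gradsq f x y * gradsq f x y * K x y
      * (h ay j x y * partial ax f x y - h ax j x y * partial ay f x y).
Proof.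
  intros S Hf Hn.
  pose proof (fun i j => hess_smooth h A K f i j S Hf) as HM.
  pose proof (hess_tr_smooth h A K f S Hf) as HT.
  pose proof (gradsq_smooth f Hf) as HN.
  assert (D : forall k i,
    partial k (gradsq f) x y * hess A f i j x y
      + gradsq f x y * partial k (hess A f i j) x y
    = partial k (hess_tr A f) x y * (partial i f x y * partial j f x y)
      + hess_tr A f x y * (partial k (partial i f) x y * partial j f x y
                           + partial i f x y * partial k (partial j f) x y)).
  { intros k i. rewrite <- !partial_mult by auto.
    rewrite <- (partial_mult k (partial i f) (partial j f)) by solve_smooth.
    rewrite <- (partial_mult k (hess_tr A f) (fun u v => partial i f u v * partial j f u v))
      by solve_smooth.
    f_equal. extensionality u; extensionality v. now apply hess_rank_one with h K. }
  pose proof (D ax ay) as D1. pose proof (D ay ax) as D2.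
  rewrite (partial_comm f) in D2 by exact Hf.
  pose proof (hess_codazzi h A K f j x y S Hf) as C. unfold sum_axis in C.
  assert (Hj : forall k, partial k (partial j f) x y = hess A f k j x y
    + (A ax k j x y * partial ax f x y + A ay k j x y * partial ay f x y)).
  { intros k. unfold hess. ring. }
  rewrite Hj in D1, D2.
  pose proof (hess_parallel h A K f j x y S Hf Hn) as P.
  pose proof (fun i k => hess_rank_one h A K f i k x y S Hf Hn) as R.
  set (N := gradsq f x y) in *. set (T := hess_tr A f x y) in *.
  set (p := partial ax f x y) in *. set (q := partial ay f x y) in *.
  apply (f_equal (Rmult N)) in D1, D2. apply (f_equal (Rmult (N * N))) in C.
  apply (f_equal (Rmult (N * T))) in P.
  pose proof (f_equal (Rmult (partial ax (gradsq f) x y)) (R ay j)) as R1.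
  pose proof (f_equal (Rmult (partial ay (gradsq f) x y)) (R ax j)) as R2.
  pose proof (f_equal (Rmult (N * A ax ax j x y)) (R ay ax)) as R3.
  pose proof (f_equal (Rmult (N * A ay ax j x y)) (R ay ay)) as R4.
  pose proof (f_equal (Rmult (N * A ax ay j x y)) (R ax ax)) as R5.
  pose proof (f_equal (Rmult (N * A ay ay j x y)) (R ax ay)) as R6.
  fold p q in R1, R2, R3, R4, R5, R6.
  lra.
Qed.

Lemma cograd_lower h A K f j x y : lorentzian_surface h A K ->
  h ax j x y * cograd h f ax x y + h ay j x y * cograd h f ay x y
  = metric_det h x y * partial j f x y.
Proof.
  intros S. unfold metric_det. destruct j; unfold cograd;
  rewrite (surface_sym_h _ _ _ S); ring.
Qed.

Lemma gradsq_eq_0 f x y : gradsq f x y = 0 -> forall i, partial i f x y = 0.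
Proof. unfold gradsq. intros H []; nra. Qed.

Lemma along_critical h f g x y : gradsq f x y = 0 -> along h f g x y = 0.
Proof.
  intros H. pose proof (gradsq_eq_0 f x y H) as H0.
  unfold along, cograd. rewrite !H0. ring.
Qed.

(* The Riccati equation of the ratio [hess_tr / gradsq] along the null gradient,
   cleared of denominators. *)
Lemma along_hess_tr h A K f x y : lorentzian_surface h A K -> smooth f ->
  grad_null h f ->
  gradsq f x y * along h f (hess_tr A f) x y
  = metric_det h x y * (gradsq f x y * gradsq f x y) * K x y
    + hess_tr A f x y * along h f (gradsq f) x y.
Proof.
  intros S Hf Hn.
  destruct (Req_dec (gradsq f x y) 0) as [Hz|Hz].
  { rewrite !along_critical, Hz by exact Hz. ring. }
  pose proof (hess_tr_curl h A K f ax x y S Hf Hn) as C1.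
  pose proof (hess_tr_curl h A K f ay x y S Hf Hn) as C2.
  pose proof (cograd_lower h A K f ax x y S) as L1.
  pose proof (cograd_lower h A K f ay x y S) as L2.
  specialize (Hn x y). unfold along.
  set (a := cograd h f ax x y) in *. set (b := cograd h f ay x y) in *.
  assert (EN : gradsq f x y = partial ax f x y * partial ax f x y
                             + partial ay f x y * partial ay f x y) by reflexivity.
  set (N := gradsq f x y) in *. set (T := hess_tr A f x y) in *.
  set (p := partial ax f x y) in *. set (q := partial ay f x y) in *.
  set (Tx := partial ax (hess_tr A f) x y) in *.
  set (Ty := partial ay (hess_tr A f) x y) in *.
  set (Nx := partial ax (gradsq f) x y) in *.
  set (Ny := partial ay (gradsq f) x y) in *.
  (* As [a p + b q = 0], the vector [(a, b)] is [nu / N] times [(q, - p)]; multiplying by [nu]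
     therefore turns [X q - Y p] into [N] times the derivative along [(a, b)]. *)
  set (nu := a * q - b * p).
  assert (Ha : nu * q = N * a).
  { transitivity (N * a - p * (a * p + b * q)); [|rewrite Hn; ring].
    rewrite EN; unfold nu; ring. }
  assert (Hb : nu * p = - (N * b)).
  { transitivity (- (N * b) + q * (a * p + b * q)); [|rewrite Hn; ring].
    rewrite EN; unfold nu; ring. }
  assert (Hc : forall X Y, nu * (X * q - Y * p) = N * (a * X + b * Y)).
  { intros X Y. transitivity (X * (nu * q) - Y * (nu * p)); [ring|].
    rewrite Ha, Hb. ring. }
  assert (Hj : forall j, N * partial j f x y * (N * (a * Tx + b * Ty)) =
    N * partial j f x y *
      (metric_det h x y * (N * N) * K x y + T * (a * Nx + b * Ny))).
  { intros j.
    assert (CC : N * partial j f x y * (Tx * q - Ty * p) =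
      T * partial j f x y * (Nx * q - Ny * p)
      - N * N * K x y * (h ay j x y * p - h ax j x y * q)) by (destruct j; assumption).
    assert (LL : h ax j x y * a + h ay j x y * b = metric_det h x y * partial j f x y)
      by (destruct j; assumption).
    apply (f_equal (Rmult nu)) in CC.
    transitivity (N * partial j f x y * (nu * (Tx * q - Ty * p)));
      [rewrite Hc; ring|].
    transitivity (nu * (N * partial j f x y * (Tx * q - Ty * p))); [ring|].
    rewrite CC.
    transitivity (T * partial j f x y * (nu * (Nx * q - Ny * p))
      - N * N * K x y * (h ay j x y * (nu * p) - h ax j x y * (nu * q))); [ring|].
    rewrite Hc, Ha, Hb.
    transitivity (T * partial j f x y * (N * (a * Nx + b * Ny))
      + N * N * K x y * N * (h ax j x y * a + h ay j x y * b)); [ring|].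
    rewrite LL. ring. }
  apply Rmult_eq_reg_l with (N * N); [|now apply Rmult_integral_contrapositive].
  pose proof (f_equal (Rmult p) (Hj ax)) as J1.
  pose proof (f_equal (Rmult q) (Hj ay)) as J2. fold p in J1. fold q in J2.
  assert (Hsq : forall X, N * N * X = p * (N * p * X) + q * (N * q * X)).
  { intros X. transitivity ((p * p + q * q) * (N * X)); [rewrite <- EN; ring|ring]. }
  rewrite !Hsq, J1, J2. reflexivity.
Qed.

(** By [hess_cograd] the Hessian part of the second derivatives cancels. What is left is cubic in
    [df], since [cograd] is itself linear in [df]. *)
Lemma along_gradsq h A K f x y : lorentzian_surface h A K -> smooth f ->
  grad_null h f ->
  along h f (gradsq f) x y =
  2 * sum_axis (fun i => sum_axis (fun k => sum_axis (fun l =>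
        cograd h f k x y * A l k i x y * partial l f x y * partial i f x y))).
Proof.
  intros S Hf Hn.
  pose proof (hess_cograd h A K f ax x y S Hf Hn) as H1.
  pose proof (hess_cograd h A K f ay x y S Hf Hn) as H2.
  apply (f_equal (Rmult (partial ax f x y))) in H1.
  apply (f_equal (Rmult (partial ay f x y))) in H2.
  unfold along, gradsq, sum_axis. expand_partial. unfold hess in *.
  rewrite ?(surface_sym_A _ _ _ S) in *.
  rewrite ?(partial_comm f) in * by exact Hf. lra.
Qed.

(** * Uniform bounds on the torus *)

Lemma uniform_bound_axis (P : axis -> R -> Prop) :
  (forall i B B', P i B -> B <= B' -> P i B') ->
  (forall i, exists B, 0 < B /\ P i B) -> exists B, 0 < B /\ forall i, P i B.
Proof.
  intros Hm HP. destruct (HP ax) as (B1 & P1 & P1'), (HP ay) as (B2 & P2 & P2').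
  exists (B1 + B2). split; [lra|]. intros []; eapply Hm; eauto; lra.
Qed.

Lemma surface_bound h A K : lorentzian_surface h A K ->
  exists B, 0 < B /\ (forall i j x y, Rabs (h i j x y) <= B) /\
    (forall k i j x y, Rabs (A k i j x y) <= B).
Proof.
  intros S. surface_hyps S.
  destruct (uniform_bound_axis (fun i B => forall j x y, Rabs (h i j x y) <= B))
    as (B1 & P1 & P1').
  { intros i B B' HB HBB j x y. apply Rle_trans with (2 := HBB), HB. }
  { intros i. apply uniform_bound_axis.
    - intros j B B' HB HBB x y. apply Rle_trans with (2 := HBB), HB.
    - intros j. apply periodic_bounded; [apply (surface_periodic_h _ _ _ S)|].
      now apply smooth_cont2. }
  destruct (uniform_bound_axis (fun k B => forall i j x y, Rabs (A k i j x y) <= B))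
    as (B2 & P2 & P2').
  { intros k B B' HB HBB i j x y. apply Rle_trans with (2 := HBB), HB. }
  { intros k. apply uniform_bound_axis.
    - intros i B B' HB HBB j x y. apply Rle_trans with (2 := HBB), HB.
    - intros i. apply uniform_bound_axis.
      + intros j B B' HB HBB x y. apply Rle_trans with (2 := HBB), HB.
      + intros j. apply periodic_bounded; [apply (surface_periodic_A _ _ _ S)|].
        now apply smooth_cont2. }
  exists (B1 + B2). split; [lra|split]; intros.
  - apply Rle_trans with B1; [apply P1'|lra].
  - apply Rle_trans with B2; [apply P2'|lra].
Qed.

Lemma Rabs_mult_le a b p q : Rabs a <= p -> Rabs b <= q -> Rabs (a * b) <= p * q.
Proof. intros. rewrite Rabs_mult. apply Rmult_le_compat; auto using Rabs_pos. Qed.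

Lemma Rabs_sum_axis_le F B : (forall i, Rabs (F i) <= B) -> Rabs (sum_axis F) <= 2 * B.
Proof.
  intros H. unfold sum_axis. apply Rle_trans with (1 := Rabs_triang _ _).
  pose proof (H ax). pose proof (H ay). lra.
Qed.

Lemma partial_le_gradsq f i x y : Rabs (partial i f x y) <= sqrt (gradsq f x y).
Proof.
  rewrite <- sqrt_Rsqr_abs. apply sqrt_le_1_alt. unfold Rsqr, gradsq.
  destruct i; [pose proof (Rle_0_sqr (partial ay f x y))
              |pose proof (Rle_0_sqr (partial ax f x y))]; unfold Rsqr in *; lra.
Qed.

Lemma along_gradsq_bound h A K f : lorentzian_surface h A K -> smooth f ->
  grad_null h f ->
  exists C, 0 < C /\ forall x y, Rabs (along h f (gradsq f) x y)
                                 <= C * (gradsq f x y * sqrt (gradsq f x y)).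
Proof.
  intros S Hf Hn. destruct (surface_bound h A K S) as (B & HB & Hh & HA).
  (* A factor 2 from [along_gradsq], one from each of its three sums, and one from the two terms of
     [cograd]; the two factors [B] bound [h] and [A]. *)
  exists (32 * (B * B)). split; [nra|]. intros x y.
  rewrite (along_gradsq h A K) by assumption.
  assert (HN : 0 <= gradsq f x y) by (unfold gradsq; nra).
  set (n := sqrt (gradsq f x y)).
  assert (Hp : forall i, Rabs (partial i f x y) <= n) by (intros; apply partial_le_gradsq).
  assert (Hc : forall k, Rabs (cograd h f k x y) <= 2 * (B * n)).
  { intros k. replace (2 * (B * n)) with (B * n + B * n) by ring.
    destruct k; unfold cograd, Rminus; apply Rle_trans with (1 := Rabs_triang _ _);
      rewrite Rabs_Ropp; apply Rplus_le_compat; apply Rabs_mult_le; auto. }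
  replace (32 * (B * B) * (gradsq f x y * n))
    with (2 * (2 * (2 * (2 * (2 * (B * n) * B * n * n))))).
  - apply Rabs_mult_le; [rewrite Rabs_pos_eq; lra|].
    do 3 (apply Rabs_sum_axis_le; intros ?). repeat apply Rabs_mult_le; auto.
  - rewrite <- (sqrt_sqrt _ HN). fold n. ring.
Qed.

(** * The regularized divergence argument *)

Definition area (h : tensor2_field) : scalar_field :=
  fun x y => sqrt (- metric_det h x y).

Lemma area_pos h A K x y : lorentzian_surface h A K -> 0 < area h x y.
Proof. intros S. apply sqrt_lt_R0. pose proof (surface_det _ _ _ S x y). lra. Qed.

Lemma area_sqr h A K x y : lorentzian_surface h A K ->
  area h x y * area h x y = h ax ay x y * h ax ay x y - h ax ax x y * h ay ay x y.
Proof.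
  intros S. unfold area. pose proof (surface_det _ _ _ S x y).
  rewrite sqrt_sqrt by lra. unfold metric_det. rewrite (surface_sym_h _ _ _ S). ring.
Qed.

Lemma area_smooth h A K : lorentzian_surface h A K -> smooth (area h).
Proof.
  intros S. surface_hyps S. unfold area. apply smooth_sqrt.
  - unfold metric_det. solve_smooth.
  - intros x y. pose proof (surface_det _ _ _ S x y). lra.
Qed.

Lemma area_periodic h A K : lorentzian_surface h A K -> periodic (area h).
Proof.
  intros S x y. pose proof (surface_periodic_h _ _ _ S) as P.
  unfold area, metric_det.
  split; [rewrite !(proj1 (P _ _ x y))|rewrite !(proj2 (P _ _ x y))]; reflexivity.
Qed.

(** The area form is parallel, so the logarithmic derivative of its density is the trace of the
    connection. *)
Lemma partial_area h A K i x y : lorentzian_surface h A K ->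
  partial i (area h) x y = area h x y * (A ax i ax x y + A ay i ay x y).
Proof.
  intros S. surface_hyps S. pose proof (area_smooth h A K S) as Hs.
  pose proof (area_pos h A K x y S) as Hp.
  assert (D : partial i (fun u v => area h u v * area h u v) x y =
    partial i (fun u v => h ax ay u v * h ax ay u v - h ax ax u v * h ay ay u v) x y).
  { f_equal. extensionality u; extensionality v. now apply area_sqr with A K. }
  revert D. expand_partial. rewrite !(surface_compatible _ _ _ S). unfold sum_axis.
  rewrite ?(surface_sym_h _ _ _ S). intros D.
  pose proof (area_sqr h A K x y S) as Q.
  apply (f_equal (Rmult (A ax i ax x y + A ay i ay x y))) in Q.
  apply Rmult_eq_reg_l with (area h x y); [|lra]. lra.
Qed.

(** [cograd h f / area h] is [- area h] times the gradient, and the coordinate divergence of a field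
    weighted by [area h] is its covariant divergence times [area h]. By [laplacian_zero] the
    gradient is divergence-free, so only the derivative of [phi] survives. *)
Lemma divergence_cograd h A K f phi x y : lorentzian_surface h A K ->
  smooth f -> smooth phi -> grad_null h f ->
  partial ax (fun x y => phi x y * cograd h f ax x y / area h x y) x y
  + partial ay (fun x y => phi x y * cograd h f ay x y / area h x y) x y
  = along h f phi x y / area h x y.
Proof.
  intros S Hf Hphi Hn. surface_hyps S.
  pose proof (area_smooth h A K S) as Hs.
  pose proof (area_pos h A K x y S) as Hp.
  assert (Hz : forall u v, area h u v <> 0).
  { intros u v. apply Rgt_not_eq. now apply area_pos with A K. }
  pose proof (fun i => cograd_smooth h A K f i S Hf) as Hw.
  rewrite !partial_div by (auto; apply smooth_mult; auto).
  rewrite !partial_mult by auto.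
  rewrite !(partial_area h A K _ x y S).
  pose proof (laplacian_zero h A K f x y S Hf Hn) as L.
  assert (Dw : partial ax (cograd h f ax) x y + partial ay (cograd h f ay) x y =
    cograd h f ax x y * (A ax ax ax x y + A ay ax ay x y)
    + cograd h f ay x y * (A ax ay ax x y + A ay ay ay x y)).
  { unfold hess, cograd in *. revert L. expand_partial.
    rewrite !(surface_compatible _ _ _ S). unfold sum_axis.
    rewrite ?(surface_sym_h _ _ _ S), ?(surface_sym_A _ _ _ S), ?(partial_comm f) by exact Hf.
    intros L. lra. }
  unfold along.
  transitivity ((cograd h f ax x y * partial ax phi x y + cograd h f ay x y * partial ay phi x y
    + phi x y * ((partial ax (cograd h f ax) x y + partial ay (cograd h f ay) x y)
      - (cograd h f ax x y * (A ax ax ax x y + A ay ax ay x y)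
         + cograd h f ay x y * (A ax ay ax x y + A ay ay ay x y)))) / area h x y).
  - field. lra.
  - rewrite Dw. field. lra.
Qed.

(* With [s = S / (N + e)], [e = eta ^ 2], [N = n ^ 2]: the error term
   [(wN / N) e s / ((N + e) (1 + s ^ 2))] is [O(eta)] because
   [2 |s| <= 1 + s ^ 2] and [2 n eta <= N + e]. *)
Lemma regularized_riccati_bound (r K N n S wS wN C B eta : R) :
  0 < r -> 0 <= n -> N = n * n -> 0 < eta -> eta <= 1 -> 0 < C -> 0 < B ->
  Rabs wN <= C * (N * n) -> Rabs (K / r) <= B -> (N = 0 -> wS = 0) ->
  N * wS = - (r * r) * (N * N) * K + S * wN ->
  r * (K * K) * (N * N) / ((N + 1) * (N + 1) + S * S)
  <= - (K * ((wS * (N + eta * eta) - S * wN) / ((N + eta * eta) * (N + eta * eta))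
             / (1 + S / (N + eta * eta) * (S / (N + eta * eta)))) / r)
     + B * C * eta.
Proof.
  intros Hr Hn EN He He1 HC HB HwN HK H0 HwS.
  assert (HN : 0 <= N) by nra.
  destruct (Req_dec N 0) as [Hz|Hz].
  { assert (wN = 0).
    { rewrite Hz in HwN. pose proof (Rabs_pos wN).
      apply Rabs_eq_0. rewrite Rmult_0_l, Rmult_0_r in HwN. lra. }
    rewrite (H0 Hz), H, Hz. unfold Rdiv. rewrite !Rmult_0_l, !Rmult_0_r, !Rmult_0_l.
    rewrite Rminus_0_r, !Rmult_0_l, Rmult_0_r, Rmult_0_l.
    assert (0 < B * C) by nra. nra. }
  set (M := N + eta * eta). assert (HM : 0 < M) by (unfold M; nra).
  set (Q := M * M + S * S). assert (HQ : 0 < Q) by (unfold Q; nra).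
  set (Z := wN / N).
  assert (HZ : wN = Z * N) by (unfold Z; field; exact Hz).
  assert (HwS' : wS = - (r * r) * N * K + S * Z).
  { apply Rmult_eq_reg_l with N; [|exact Hz]. rewrite HwS, HZ. ring. }
  assert (HZb : Rabs Z <= C * n).
  { apply Rmult_le_reg_r with N; [lra|].
    rewrite HZ, Rabs_mult, (Rabs_pos_eq N) in HwN by lra. lra. }
  (* Exact splitting into a nonnegative main term and the error proportional to
     [eta * eta = M - N]. *)
  assert (E : - (K * ((wS * M - S * wN) / (M * M) / (1 + S / M * (S / M))) / r)
    = r * (K * K) * N * M / Q - (K / r) * (Z * (eta * eta) * S) / Q).
  { rewrite HwS', HZ. unfold Q.
    replace (eta * eta) with (M - N) by (unfold M; ring).
    field. split; [lra|split; [|lra]]. nra. }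
  rewrite E.
  (* As [N <= M <= N + 1], the main term has a lower bound independent of [eta]; this uses
     [eta <= 1]. *)
  assert (I1 : r * (K * K) * (N * N) / ((N + 1) * (N + 1) + S * S)
               <= r * (K * K) * N * M / Q).
  { assert (HD : 0 < (N + 1) * (N + 1) + S * S) by nra.
    apply Rmult_le_reg_r with (((N + 1) * (N + 1) + S * S) * Q); [nra|].
    replace (r * (K * K) * (N * N) / ((N + 1) * (N + 1) + S * S)
             * (((N + 1) * (N + 1) + S * S) * Q))
      with (r * (K * K) * N * (N * Q)) by (field; lra).
    replace (r * (K * K) * N * M / Q * (((N + 1) * (N + 1) + S * S) * Q))
      with (r * (K * K) * N * (M * ((N + 1) * (N + 1) + S * S))) by (field; lra).
    apply Rmult_le_compat_l.
    - apply Rmult_le_pos; [|lra]. apply Rmult_le_pos; nra.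
    - assert (N <= M /\ M <= N + 1) by (unfold M; split; nra).
      assert (N * (S * S) <= M * (S * S)) by (apply Rmult_le_compat_r; nra).
      assert (N * (M * M) <= M * ((N + 1) * (N + 1))).
      { replace (N * (M * M)) with (M * (N * M)) by ring.
        apply Rmult_le_compat_l; [lra|]. apply Rmult_le_compat; lra. }
      unfold Q. lra. }
  assert (I2 : Rabs ((K / r) * (Z * (eta * eta) * S)) <= B * C * eta * Q).
  { apply Rle_trans with (B * (C * n * (eta * eta) * Rabs S)).
    - apply Rabs_mult_le; [exact HK|]. apply Rabs_mult_le; [|lra].
      apply Rabs_mult_le; [exact HZb|]. rewrite Rabs_pos_eq; nra.
    - assert (Hs : 2 * (M * Rabs S) <= Q).
      { unfold Q. pose proof (Rle_0_sqr (M - Rabs S)) as H. unfold Rsqr in H.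
        assert (Rabs S * Rabs S = S * S) by (rewrite <- Rabs_mult; apply Rabs_pos_eq; nra).
        lra. }
      assert (Hm : 2 * (n * eta) <= M).
      { unfold M. rewrite EN. pose proof (Rle_0_sqr (n - eta)) as H. unfold Rsqr in H. lra. }
      pose proof (Rabs_pos S).
      assert (n * eta * Rabs S <= Q).
      { assert (n * eta * Rabs S <= M * Rabs S) by (apply Rmult_le_compat_r; nra).
        assert (0 <= M * Rabs S) by nra. lra. }
      replace (B * (C * n * (eta * eta) * Rabs S))
        with (B * C * eta * (n * eta * Rabs S)) by ring.
      apply Rmult_le_compat_l; [|assumption].
      assert (0 < B * C) by nra. nra. }
  assert (I3 : (K / r) * (Z * (eta * eta) * S) / Q <= B * C * eta).
  { apply Rmult_le_reg_r with Q; [exact HQ|].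
    replace ((K / r) * (Z * (eta * eta) * S) / Q * Q)
      with ((K / r) * (Z * (eta * eta) * S)) by (field; lra).
    apply Rle_trans with (2 := I2), Rle_abs. }
  lra.
Qed.

Ltac periodic_step :=
  match goal with
  | |- periodic (fun x y => ?f x y) => first [assumption | change (periodic f); assumption]
  | |- periodic (fun x y => partial ?i ?f x y) => apply (periodic_partial i f)
  | |- periodic (partial ?i ?f) => apply (periodic_partial i f)
  | |- periodic (fun x y => _ + _) => apply (periodic_op2 Rplus)
  | |- periodic (fun x y => _ - _) => apply (periodic_op2 Rminus)
  | |- periodic (fun x y => _ * _) => apply (periodic_op2 Rmult)
  | |- periodic (fun x y => _ / _) => apply (periodic_op2 Rdiv)
  | |- periodic (fun x y => - _) => apply (periodic_op1 Ropp)
  | |- periodic (fun x y => atan _) => apply (periodic_op1 atan)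
  | |- periodic (fun _ _ => ?c) => apply (periodic_const c)
  end.
Ltac solve_periodic := repeat periodic_step; auto.

Lemma curvature_gradient_zero h A K : lorentzian_surface h A K -> grad_null h K ->
  forall x y, K x y * gradsq K x y = 0.
Proof.
  intros S Hn. surface_hyps S.
  pose proof (area_smooth h A K S) as Hr.
  pose proof (hess_tr_smooth h A K K S ltac:(assumption)) as HT.
  pose proof (gradsq_smooth K ltac:(assumption)) as HN.
  pose proof (fun i => cograd_smooth h A K K i S ltac:(assumption)) as Hw.
  pose proof (surface_periodic_h _ _ _ S) as Ph.
  pose proof (surface_periodic_A _ _ _ S) as PA.
  pose proof (surface_periodic_K _ _ _ S) as PK.
  pose proof (area_periodic h A K S) as Pr.
  assert (PT : periodic (hess_tr A K)) by (unfold hess_tr, hess; solve_periodic).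
  assert (PN : periodic (gradsq K)) by (unfold gradsq; solve_periodic).
  assert (Pw : forall i, periodic (cograd h K i)).
  { intros []; unfold cograd; solve_periodic. }
  assert (Hr0 : forall x y, area h x y <> 0).
  { intros x y. apply Rgt_not_eq. now apply area_pos with A K. }
  assert (HN0 : forall x y, 0 <= gradsq K x y) by (intros; unfold gradsq; nra).
  (* With [b = S / N], [N ^ 2 / (N ^ 2 + S ^ 2)] is [1 / (1 + b ^ 2)]. The [+ 1] makes the density
     smooth at critical points too, while it still vanishes only where [K * gradsq K] does. *)
  set (rho := fun x y => area h x y * (K x y * K x y) * (gradsq K x y * gradsq K x y)
    / ((gradsq K x y + 1) * (gradsq K x y + 1) + hess_tr A K x y * hess_tr A K x y)).
  assert (HD : forall x y, 0 <
    (gradsq K x y + 1) * (gradsq K x y + 1) + hess_tr A K x y * hess_tr A K x y).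
  { intros x y. specialize (HN0 x y). nra. }
  assert (Hrho : forall x y, rho x y = 0).
  { destruct (along_gradsq_bound h A K K S ltac:(assumption) Hn) as (C & HC & HCb).
    destruct (periodic_bounded (fun x y => K x y / area h x y)) as (B & HB & HBb).
    { solve_periodic. }
    { apply smooth_cont2. solve_smooth. }
    apply divergence_dominated_zero.
    - apply smooth_cont2. unfold rho. solve_smooth. intros x y. apply Rgt_not_eq, HD.
    - unfold rho. solve_periodic.
    - intros x y. unfold rho. pose proof (area_pos h A K x y S).
      apply Rmult_le_pos; [|apply Rlt_le, Rinv_0_lt_compat, HD].
      apply Rmult_le_pos; [apply Rmult_le_pos|]; nra.
    (* The second bound makes the error [B * C * eta] at most [e]. *)
    - intros e He. set (eta := Rmin 1 (e / (B * C))).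
      assert (HBC : 0 < B * C) by nra.
      assert (Heta : 0 < eta /\ eta <= 1 /\ B * C * eta <= e).
      { assert (0 < e / (B * C)) by (apply Rdiv_lt_0_compat; lra).
        split; [apply Rmin_glb_lt; lra|split; [apply Rmin_l|]].
        assert (Hle : eta <= e / (B * C)) by apply Rmin_r.
        apply (Rmult_le_compat_l (B * C)) in Hle; [|lra].
        replace (B * C * (e / (B * C))) with e in Hle by (field; lra). exact Hle. }
      assert (HM0 : forall x y, gradsq K x y + eta * eta <> 0).
      { intros x y. specialize (HN0 x y). nra. }
      set (s := fun x y => hess_tr A K x y / (gradsq K x y + eta * eta)).
      assert (Hs : smooth s) by (unfold s; solve_smooth).
      assert (Ps : periodic s) by (unfold s; solve_periodic).
      (* The sign compensates for [cograd h K / area h] being a negative multiple of the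
         gradient. *)
      set (phi := fun x y => - (K x y * atan (s x y))).
      assert (Hphi : smooth phi) by (unfold phi; solve_smooth).
      assert (Pphi : periodic phi) by (unfold phi; solve_periodic).
      exists (fun x y => phi x y * cograd h K ax x y / area h x y).
      exists (fun x y => phi x y * cograd h K ay x y / area h x y).
      split; [solve_smooth|split; [solve_smooth|split; [solve_periodic|split; [solve_periodic|]]]].
      intros x y. rewrite (divergence_cograd h A K K phi) by auto.
      assert (Hds : forall i, partial i s x y =
        (partial i (hess_tr A K) x y * (gradsq K x y + eta * eta)
         - hess_tr A K x y * partial i (gradsq K) x y)
        / ((gradsq K x y + eta * eta) * (gradsq K x y + eta * eta))).
      { intros i. unfold s. rewrite partial_div by (auto; solve_smooth).
        rewrite (partial_plus i (gradsq K) (fun _ _ => eta * eta)) by solve_smooth.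
        rewrite partial_const, Rplus_0_r. reflexivity. }
      assert (Hdphi : along h K phi x y = - (K x y *
        ((along h K (hess_tr A K) x y * (gradsq K x y + eta * eta)
          - hess_tr A K x y * along h K (gradsq K) x y)
         / ((gradsq K x y + eta * eta) * (gradsq K x y + eta * eta))
         / (1 + s x y * s x y)))).
      { assert (Hdp : forall i, partial i phi x y = - (partial i K x y * atan (s x y)
          + K x y * (partial i s x y / (1 + s x y * s x y)))).
        { intros i. unfold phi. rewrite partial_opp.
          rewrite (partial_mult i K (fun u v => atan (s u v))) by solve_smooth.
          now rewrite partial_atan. }
        unfold along. rewrite !Hdp, !Hds. specialize (Hn x y).
        assert (Hs0 : 1 + s x y * s x y <> 0) by nra.
        (* The terms in which [K] is differentiated carry the factor [cograd . dK = 0]. *)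
        assert (E : forall a b p q t X Y, a * p + b * q = 0 ->
          a * - (p * t + X) + b * - (q * t + Y) = - (a * X + b * Y)).
        { intros a b p q t X Y HH. transitivity (- (a * X + b * Y) - t * (a * p + b * q));
            [ring|rewrite HH; ring]. }
        rewrite E by exact Hn. field. auto. }
      rewrite Hdphi. unfold rho.
      apply Rle_trans with (2 := Rplus_le_compat_l _ _ _ (proj2 (proj2 Heta))).
      unfold s, Rdiv at 2. rewrite Ropp_mult_distr_l_reverse.
      apply (regularized_riccati_bound _ _ _ (sqrt (gradsq K x y))); try lra.
      + now apply area_pos with A K.
      + apply sqrt_pos.
      + symmetry. apply sqrt_sqrt, HN0.
      + apply HCb.
      + apply HBb.
      + intros Hz. now apply along_critical.
      + rewrite (along_hess_tr h A K K) by auto.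
        rewrite (area_sqr h A K) by exact S. unfold metric_det.
        rewrite (surface_sym_h _ _ _ S). ring. }
  intros x y. specialize (Hrho x y). unfold rho in Hrho.
  specialize (HD x y). pose proof (area_pos h A K x y S) as Hp.
  apply (f_equal (fun z => z * ((gradsq K x y + 1) * (gradsq K x y + 1)
    + hess_tr A K x y * hess_tr A K x y))) in Hrho.
  unfold Rdiv in Hrho. rewrite Rmult_assoc, Rinv_l, Rmult_1_r, Rmult_0_l in Hrho by lra.
  assert (E : (K x y * gradsq K x y) * (K x y * gradsq K x y) = 0).
  { apply Rmult_eq_reg_l with (area h x y); [|lra]. lra. }
  apply Rmult_integral in E. tauto.
Qed.

(** * Gauss-Bonnet *)

(** The sum of the squared Euclidean lengths of the two vectors that span the null line in
    [null_proj], that is, the trace of its numerator. *)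
Definition null_proj_den (h : tensor2_field) : scalar_field := fun x y =>
  2 * (area h x y * area h x y) + 2 * (h ax ay x y * h ax ay x y)
  + h ax ax x y * h ax ax x y + h ay ay x y * h ay ay x y.

(* Euclidean orthogonal projection onto the null line spanned by the parallel
   vectors [(r + F, - E)] and [(G, r - F)], with [r = area h]; the two of them
   are never zero at the same point. *)
Definition null_proj (h : tensor2_field) : tensor2_field := fun i j x y =>
  match i, j with
  | ax, ax => (area h x y + h ax ay x y) * (area h x y + h ax ay x y)
              + h ay ay x y * h ay ay x y
  | ay, ay => h ax ax x y * h ax ax x y
              + (area h x y - h ax ay x y) * (area h x y - h ax ay x y)
  | _, _ => h ay ay x y * (area h x y - h ax ay x y)
            - h ax ax x y * (area h x y + h ax ay x y)
  end / null_proj_den h x y.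

Lemma null_proj_den_pos h A K x y : lorentzian_surface h A K ->
  0 < null_proj_den h x y.
Proof. intros S. pose proof (area_pos h A K x y S). unfold null_proj_den. nra. Qed.

Lemma null_proj_smooth h A K i j : lorentzian_surface h A K -> smooth (null_proj h i j).
Proof.
  intros S. surface_hyps S. pose proof (area_smooth h A K S).
  assert (smooth (null_proj_den h)) by (unfold null_proj_den; solve_smooth).
  assert (forall x y, null_proj_den h x y <> 0).
  { intros x y. apply Rgt_not_eq. now apply null_proj_den_pos with A K. }
  destruct i, j; unfold null_proj; solve_smooth.
Qed.

Lemma null_proj_periodic h A K i j : lorentzian_surface h A K ->
  periodic (null_proj h i j).
Proof.
  intros S. pose proof (surface_periodic_h _ _ _ S). pose proof (area_periodic h A K S).
  assert (periodic (null_proj_den h)) by (unfold null_proj_den; solve_periodic).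
  destruct i, j; unfold null_proj; solve_periodic.
Qed.

Lemma null_proj_trace h A K x y : lorentzian_surface h A K ->
  null_proj h ax ax x y + null_proj h ay ay x y = 1.
Proof.
  intros S. pose proof (null_proj_den_pos h A K x y S) as Hp.
  unfold null_proj. unfold null_proj_den in *. field. lra.
Qed.

Lemma null_proj_det h A K x y : lorentzian_surface h A K ->
  null_proj h ax ax x y * null_proj h ay ay x y
  - null_proj h ax ay x y * null_proj h ax ay x y = 0.
Proof.
  intros S. pose proof (null_proj_den_pos h A K x y S) as Hp.
  pose proof (area_sqr h A K x y S) as Q. unfold null_proj.
  set (r := area h x y) in *. set (E := h ax ax x y) in *.
  set (F := h ax ay x y) in *. set (G := h ay ay x y) in *.
  transitivity (((r * r - (F * F - E * G)) * (r * r - (F * F - E * G)))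
    / (null_proj_den h x y * null_proj_den h x y)).
  - field. lra.
  - rewrite Q. field. lra.
Qed.

Lemma null_proj_null h A K x y : lorentzian_surface h A K ->
  h ax ax x y * null_proj h ax ax x y + 2 * (h ax ay x y * null_proj h ax ay x y)
  + h ay ay x y * null_proj h ay ay x y = 0.
Proof.
  intros S. pose proof (null_proj_den_pos h A K x y S) as Hp.
  pose proof (area_sqr h A K x y S) as Q. unfold null_proj.
  set (r := area h x y) in *. set (E := h ax ax x y) in *.
  set (F := h ax ay x y) in *. set (G := h ay ay x y) in *.
  transitivity ((E + G) * (r * r - (F * F - E * G)) / null_proj_den h x y).
  - field. lra.
  - rewrite Q. field. lra.
Qed.

(** For a Euclidean unit vector [u] of the null line and [J] the quarter turn, the left side is
    [h(u, J u)]. Its square is [- metric_det h], since [u] is null and [(u, J u)] is orthonormal;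
    its sign records which of the two null lines was chosen. *)
Lemma null_proj_area h A K x y : lorentzian_surface h A K ->
  h ax ay x y * (null_proj h ax ax x y - null_proj h ay ay x y)
  + (h ay ay x y - h ax ax x y) * null_proj h ax ay x y = area h x y.
Proof.
  intros S. pose proof (null_proj_den_pos h A K x y S) as Hp.
  pose proof (area_sqr h A K x y S) as Q. unfold null_proj. unfold null_proj_den in *.
  set (r := area h x y) in *. set (E := h ax ax x y) in *.
  set (F := h ax ay x y) in *. set (G := h ay ay x y) in *.
  apply Rmult_eq_reg_r with (2 * (r * r) + 2 * (F * F) + E * E + G * G); [|lra].
  transitivity (F * ((r + F) * (r + F) + G * G - (E * E + (r - F) * (r - F)))
    + (G - E) * (G * (r - F) - E * (r + F))); [field; lra|].
  apply (f_equal (Rmult (2 * r))) in Q. lra.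
Qed.

(** The connection form [w] in [nabla_i u = w_i u] for a Euclidean unit vector [u] of the null line:
    the Euclidean product of [nabla_i u] with [u], where the derivative of [u] itself contributes
    nothing. It depends on [u] only through the projection [u u^T], so no global choice of sign is
    needed. *)
Definition null_conn (h : tensor2_field) (A : axis -> tensor2_field) (i : axis) :
    scalar_field :=
  fun x y => A ax i ax x y * null_proj h ax ax x y + A ax i ay x y * null_proj h ax ay x y
             + A ay i ax x y * null_proj h ax ay x y + A ay i ay x y * null_proj h ay ay x y.

(* Three linear equations determine the derivative of the projection [Q]:
   differentiate [tr Q = 1], [tr (h Q) = 0] and [det Q = 0]. *)
Lemma null_proj_linear_unique (E F G a b c p q s r : R) :
  F * (a - c) + (G - E) * b = r -> r <> 0 ->
  p + s = 0 -> E * p + 2 * (F * q) + G * s = 0 -> c * p + a * s - 2 * (b * q) = 0 ->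
  p = 0 /\ q = 0 /\ s = 0.
Proof.
  intros Hr Hr0 H1 H2 H3. assert (s = - p) by lra. subst s.
  assert (Hp : r * p = 0).
  { rewrite <- Hr. apply (f_equal (Rmult b)) in H2. apply (f_equal (Rmult F)) in H3. lra. }
  assert (Hq : r * q = 0).
  { rewrite <- Hr. apply (f_equal (Rmult (a - c))) in H2.
    apply (f_equal (Rmult (E - G))) in H3. lra. }
  apply Rmult_integral in Hp, Hq. repeat split; [tauto|tauto|].
  destruct Hp; [tauto|lra].
Qed.

(** The derivative of [u u^T] when [nabla u = w u]: parallel transport preserves the null lines. *)
Lemma partial_null_proj h A K k x y : lorentzian_surface h A K ->
  (forall i j, partial k (null_proj h i j) x y =
   2 * null_conn h A k x y * null_proj h i j x y
   - sum_axis (fun m => A i k m x y * null_proj h m j x y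
                        + null_proj h i m x y * A j k m x y)).
Proof.
  intros S. surface_hyps S. pose proof (fun i j => null_proj_smooth h A K i j S) as HQ.
  assert (Z : forall f : scalar_field, forall c, (forall u v, f u v = c) -> partial k f x y = 0).
  { intros f c Hf. rewrite <- (partial_const k c x y). f_equal.
    extensionality u; extensionality v. apply Hf. }
  pose proof (Z _ _ (fun u v => null_proj_trace h A K u v S)) as D1.
  pose proof (Z _ _ (fun u v => null_proj_null h A K u v S)) as D2.
  pose proof (Z _ _ (fun u v => null_proj_det h A K u v S)) as D3.
  pose proof (null_proj_trace h A K x y S) as E1.
  pose proof (null_proj_null h A K x y S) as E2.
  pose proof (null_proj_det h A K x y S) as E3.
  pose proof (null_proj_area h A K x y S) as E4.
  pose proof (area_pos h A K x y S) as Hp.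
  assert (Sym : null_proj h ay ax = null_proj h ax ay) by reflexivity.
  revert D1 D2 D3. expand_partial. rewrite !(surface_compatible _ _ _ S).
  unfold null_conn, sum_axis. rewrite ?(surface_sym_h _ _ _ S), ?Sym.
  set (a := null_proj h ax ax) in *. set (b := null_proj h ax ay) in *.
  set (c := null_proj h ay ay) in *.
  set (w := A ax k ax x y * a x y + A ax k ay x y * b x y
            + A ay k ax x y * b x y + A ay k ay x y * c x y).
  intros D1 D2 D3.
  (* The differences between the derivatives and their claimed values solve the homogeneous system
     of the three differentiated constraints. *)
  assert (U :
    partial k a x y - (2 * w * a x y
      - (A ax k ax x y * a x y + a x y * A ax k ax x y
         + (A ax k ay x y * b x y + b x y * A ax k ay x y))) = 0 /\
    partial k b x y - (2 * w * b x y
      - (A ax k ax x y * b x y + a x y * A ay k ax x y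
         + (A ax k ay x y * c x y + b x y * A ay k ay x y))) = 0 /\
    partial k c x y - (2 * w * c x y
      - (A ay k ax x y * b x y + b x y * A ay k ax x y
         + (A ay k ay x y * c x y + c x y * A ay k ay x y))) = 0).
  { apply (null_proj_linear_unique (h ax ax x y) (h ax ay x y) (h ay ay x y)
             (a x y) (b x y) (c x y)) with (area h x y); [exact E4|lra| | |].
    - apply (f_equal (Rmult w)) in E1. unfold w in *. lra.
    - apply (f_equal (Rmult w)) in E2. lra.
    - pose proof (f_equal (Rmult w) E3). 
      pose proof (f_equal (Rmult (A ax k ax x y + A ay k ay x y)) E3). lra. }
  destruct U as (U1 & U2 & U3).
  intros [] []; fold a b c; rewrite ?Sym; fold b; lra.
Qed.

(* Gauss-Bonnet: the curvature form is the exterior derivative of the globally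
   defined connection form of the null line bundle. *)
Lemma curl_null_conn h A K x y : lorentzian_surface h A K ->
  partial ax (null_conn h A ay) x y - partial ay (null_conn h A ax) x y
  = K x y * area h x y.
Proof.
  intros S. surface_hyps S. pose proof (fun i j => null_proj_smooth h A K i j S) as HQ.
  assert (Sym : null_proj h ay ax = null_proj h ax ay) by reflexivity.
  pose proof (null_proj_area h A K x y S) as E4.
  (* Contracting the curvature with the projection gives [K * h(u, J u)], which is [K * area h] by
     [null_proj_area]; the quadratic terms in [null_conn] cancel in the curl. *)
  pose proof (fun l k => f_equal (Rmult (null_proj h l k x y))
                (surface_curvature _ _ _ S l k x y)) as R.
  pose proof (R ax ax) as R1. pose proof (R ax ay) as R2.
  pose proof (R ay ax) as R3. pose proof (R ay ay) as R4. clear R.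
  apply (f_equal (Rmult (K x y))) in E4.
  unfold null_conn at 1 2. expand_partial.
  rewrite !(partial_null_proj h A K _ x y S).
  unfold null_conn, sum_axis, delta in *.
  rewrite ?(surface_sym_h _ _ _ S), ?(surface_sym_A _ _ _ S), ?Sym in *.
  lra.
Qed.

Lemma constant_of_partial_zero f : smooth f -> (forall i x y, partial i f x y = 0) ->
  forall x y, f x y = f 0 0.
Proof.
  intros Hf Hz.
  assert (H1 : forall g : R -> R, (forall t, is_derive g t 0) -> forall t, g t = g 0).
  { intros g Hg t. destruct (MVT_gen g 0 t (fun _ => 0)) as (c & _ & E).
    - auto.
    - intros u _. apply derivable_continuous_pt. exists 0. now apply is_derive_Reals.
    - lra. }
  intros x y. transitivity (f 0 y).
  - apply (H1 (fun t => f t y)). intros t.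
    assert (D : is_derive (fun s => f s y) t (partial ax f t y)).
    { apply Derive_correct. exact (proj1 (smooth_diff1 f Hf t y)). }
    rewrite Hz in D. exact D.
  - apply (H1 (fun t => f 0 t)). intros t.
    assert (D : is_derive (fun s => f 0 s) t (partial ay f 0 t)).
    { apply Derive_correct. exact (proj2 (smooth_diff1 f Hf 0 t)). }
    rewrite Hz in D. exact D.
Qed.

(** The curl of [null_conn] is the divergence of the rotated field. Multiplying by the constant [c]
    turns the density into [c * c * area h], which is nonnegative, so [divergence_dominated_zero]
    applies whatever the sign of [c]. *)
Lemma constant_curvature_zero h A K : lorentzian_surface h A K ->
  (forall x y, K x y = K 0 0) -> K 0 0 = 0.
Proof.
  intros S Hc. surface_hyps S. set (c := K 0 0) in *.
  pose proof (fun i j => null_proj_smooth h A K i j S) as HQ.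
  pose proof (fun i j => null_proj_periodic h A K i j S) as PQ.
  pose proof (surface_periodic_A _ _ _ S) as PA.
  pose proof (area_smooth h A K S) as Hr.
  pose proof (area_periodic h A K S) as Pr.
  assert (Hw : forall i, smooth (null_conn h A i)) by (intros i; unfold null_conn; solve_smooth).
  assert (Pw : forall i, periodic (null_conn h A i)).
  { intros i; unfold null_conn; solve_periodic. }
  pose proof (area_pos h A K 0 0 S) as Hp.
  assert (Z : c * c * area h 0 0 = 0).
  { apply (divergence_dominated_zero (fun x y => c * c * area h x y)).
    - apply smooth_cont2. solve_smooth.
    - solve_periodic.
    - intros x y. pose proof (area_pos h A K x y S). nra.
    - intros e He. exists (fun x y => c * null_conn h A ay x y).
      exists (fun x y => - c * null_conn h A ax x y).
      split; [solve_smooth|split; [solve_smooth|split; [solve_periodic|split; [solve_periodic|]]]].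
      intros x y.
      rewrite (partial_mult ax (fun _ _ => c) (null_conn h A ay)) by solve_smooth.
      rewrite (partial_mult ay (fun _ _ => - c) (null_conn h A ax)) by solve_smooth.
      rewrite !partial_const.
      pose proof (curl_null_conn h A K x y S) as E. rewrite Hc in E.
      apply (f_equal (Rmult c)) in E. lra. }
  apply Rmult_integral in Z. destruct Z as [Z|Z]; [|lra].
  apply Rmult_integral in Z. tauto.
Qed.

(** From [K dK = 0] the square of [K] is constant. If that constant is nonzero, [K] vanishes
    nowhere, hence [dK = 0], and Gauss-Bonnet gives a contradiction. *)
Lemma null_gradient_flat h A K : lorentzian_surface h A K -> grad_null h K ->
  forall x y, K x y = 0.
Proof.
  intros S Hn. surface_hyps S. pose proof (curvature_gradient_zero h A K S Hn) as HKN.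
  assert (HKK : forall x y, K x y * K x y = K 0 0 * K 0 0).
  { apply (constant_of_partial_zero (fun x y => K x y * K x y)); [solve_smooth|].
    intros i x y. rewrite partial_mult by assumption.
    destruct (Rmult_integral _ _ (HKN x y)) as [E|E].
    - rewrite E. ring.
    - rewrite (gradsq_eq_0 K x y E). ring. }
  destruct (Req_dec (K 0 0) 0) as [E|E].
  - intros x y. specialize (HKK x y). rewrite E in HKK. nra.
  - exfalso. apply E, (constant_curvature_zero h A K S).
    apply constant_of_partial_zero; [assumption|]. intros i x y.
    apply gradsq_eq_0. specialize (HKN x y). specialize (HKK x y).
    destruct (Rmult_integral _ _ HKN) as [E'|E']; [|exact E'].
    rewrite E' in HKK. nra.
Qed.

(** * The Levi-Civita connection *)

(** The Gram determinant of the basis, [-1], is the determinant of [h] times the square of the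
    determinant of the basis. *)
Lemma lorentzian_at_det h x y : h ay ax = h ax ay -> lorentzian_at h x y ->
  metric_det h x y < 0.
Proof.
  intros Hs (v & w & H1 & H2 & H3). unfold apply2, sum_axis, metric_det in *.
  rewrite Hs in *.
  set (E := h ax ax x y) in *. set (F := h ax ay x y) in *. set (G := h ay ay x y) in *.
  assert (D : (E * G - F * F) * ((v ax * w ay - v ay * w ax) * (v ax * w ay - v ay * w ax))
              = -1).
  { match type of H1 with ?a = _ => match type of H2 with ?b = _ =>
      match type of H3 with ?c = _ => transitivity (a * b - c * c); [ring|] end end end.
    rewrite H1, H2, H3. ring. }
  apply Rnot_le_lt. intros Hge.
  pose proof (Rmult_le_pos _ _ Hge (Rle_0_sqr (v ax * w ay - v ay * w ax))) as Hp.
  unfold Rsqr in Hp. lra.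
Qed.

Lemma metric_sym_fun h : lorentzian_metric h -> h ay ax = h ax ay.
Proof.
  intros hh. extensionality x; extensionality y. apply (metric_sym h hh).
Qed.

Lemma metric_det_neq0 h x y : lorentzian_metric h -> metric_det h x y <> 0.
Proof.
  intros hh. apply Rlt_not_eq, lorentzian_at_det;
    [now apply metric_sym_fun|apply (metric_signature h hh)].
Qed.

Lemma christoffel_smooth h k i j : lorentzian_metric h -> smooth (christoffel h k i j).
Proof.
  intros hh. assert (Hh : forall i j, smooth (h i j)) by exact (metric_smooth h hh).
  assert (Hd : smooth (metric_det h)) by (unfold metric_det; solve_smooth).
  pose proof (fun x y => metric_det_neq0 h x y hh).
  destruct k; unfold christoffel, sum_axis, metric_inv; solve_smooth.
Qed.

Lemma christoffel_periodic h k i j : lorentzian_metric h ->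
  periodic (christoffel h k i j).
Proof.
  intros hh. pose proof (metric_periodic h hh).
  assert (Hd : periodic (metric_det h)) by (unfold metric_det; solve_periodic).
  destruct k; unfold christoffel, sum_axis, metric_inv; solve_periodic.
Qed.

Lemma christoffel_sym h k : lorentzian_metric h ->
  christoffel h k ay ax = christoffel h k ax ay.
Proof.
  intros hh. extensionality x; extensionality y. unfold christoffel, sum_axis.
  rewrite (metric_sym_fun h hh). ring.
Qed.

Lemma christoffel_compatible h i j k x y : lorentzian_metric h ->
  partial i (h j k) x y =
  sum_axis (fun l => h l k x y * christoffel h l i j x y
                     + h j l x y * christoffel h l i k x y).
Proof.
  intros hh. pose proof (metric_det_neq0 h x y hh) as Hd.
  unfold christoffel, metric_inv, sum_axis.
  unfold metric_det in *. rewrite (metric_sym_fun h hh) in *.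
  destruct i, j, k; rewrite ?(metric_sym_fun h hh); field; exact Hd.
Qed.

(* Differentiate the compatibility equation and antisymmetrize. *)
Lemma riemann_lower_antisym h j k x y : lorentzian_metric h ->
  sum_axis (fun m => h m k x y * riemann h m j ax ay x y)
  + sum_axis (fun m => h j m x y * riemann h m k ax ay x y) = 0.
Proof.
  intros hh. assert (Hh : forall i j, smooth (h i j)) by exact (metric_smooth h hh).
  pose proof (fun k i j => christoffel_smooth h k i j hh) as HA.
  pose proof (fun k => christoffel_sym h k hh) as SA.
  assert (C : forall i j k x y, partial i (h j k) x y =
    sum_axis (fun l => h l k x y * christoffel h l i j x y
                     + h j l x y * christoffel h l i k x y))
    by (intros; now apply christoffel_compatible).
  (* From here the connection enters only through its smoothness, symmetry and compatibility. *)
  unfold riemann. set (A := christoffel h) in *. clearbody A.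
  assert (CF : forall i, partial i (h j k) = fun x y =>
     (h ax k x y * A ax i j x y + h j ax x y * A ax i k x y)
     + (h ay k x y * A ay i j x y + h j ay x y * A ay i k x y)).
  { intros i. extensionality u; extensionality v. apply C. }
  pose proof (partial_comm (h j k) x y (Hh j k)) as P.
  rewrite !CF in P. revert P. expand_partial. rewrite !C. unfold sum_axis.
  rewrite (metric_sym_fun h hh).
  destruct j, k; rewrite ?(metric_sym_fun h hh), ?SA; intros P; lra.
Qed.

(** With its upper index lowered, the curvature operator of the pair [(d_x, d_y)] is an
    antisymmetric 2 by 2 matrix, hence has a single coefficient. *)
Lemma riemann_curvature h l k x y : lorentzian_metric h ->
  riemann h l k ax ay x y
  = curvature h x y * (h ay k x y * delta l ax - h ax k x y * delta l ay).
Proof.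
  intros hh. pose proof (metric_det_neq0 h x y hh) as Hd.
  pose proof (riemann_lower_antisym h ax ax x y hh) as R1.
  pose proof (riemann_lower_antisym h ax ay x y hh) as R2.
  pose proof (riemann_lower_antisym h ay ay x y hh) as R3.
  unfold curvature, sum_axis in *.
  set (D := metric_det h x y) in *.
  assert (ED : D = h ax ax x y * h ay ay x y - h ax ay x y * h ax ay x y).
  { unfold D, metric_det. now rewrite (metric_sym_fun h hh). }
  rewrite (metric_sym_fun h hh) in *.
  set (E := h ax ax x y) in *. set (F := h ax ay x y) in *. set (G := h ay ay x y) in *.
  set (a := riemann h ax ax ax ay x y) in *. set (b := riemann h ay ax ax ay x y) in *.
  set (c := riemann h ax ay ax ay x y) in *. set (d := riemann h ay ay ax ay x y) in *.
  assert (X1 : E * a + F * b = 0) by lra.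
  assert (X2 : F * c + G * d = 0) by lra.
  assert (X3 : F * a + G * b = - (c * E + d * F)) by lra.
  apply Rmult_eq_reg_l with D; [|exact Hd].
  pose proof (f_equal (Rmult E) X1). pose proof (f_equal (Rmult F) X1).
  pose proof (f_equal (Rmult G) X1). pose proof (f_equal (Rmult E) X2).
  pose proof (f_equal (Rmult F) X2). pose proof (f_equal (Rmult G) X2).
  pose proof (f_equal (Rmult E) X3). pose proof (f_equal (Rmult F) X3).
  pose proof (f_equal (Rmult G) X3).
  destruct l, k; unfold delta; rewrite ?(metric_sym_fun h hh);
    fold a b c d E F G;
    (match goal with |- _ = D * ((?n / D) * ?z) =>
       replace (D * ((n / D) * z)) with (n * z) by (field; exact Hd) end);
    rewrite ED; lra.
Qed.

Lemma lorentzian_metric_surface h : lorentzian_metric h ->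
  lorentzian_surface h (christoffel h) (curvature h).
Proof.
  intros hh. assert (Hh : forall i j, smooth (h i j)) by exact (metric_smooth h hh).
  pose proof (metric_periodic h hh) as Ph.
  pose proof (fun k i j => christoffel_smooth h k i j hh) as HA.
  pose proof (fun k i j => christoffel_periodic h k i j hh) as PA.
  assert (Hd : smooth (metric_det h)) by (unfold metric_det; solve_smooth).
  assert (Pd : periodic (metric_det h)) by (unfold metric_det; solve_periodic).
  pose proof (fun x y => metric_det_neq0 h x y hh) as Hd0.
  split; auto.
  - unfold curvature, riemann, sum_axis. solve_smooth.
  - unfold curvature, riemann, sum_axis. solve_periodic.
  - now apply metric_sym_fun.
  - intros k. now apply christoffel_sym.
  - intros x y. apply lorentzian_at_det; [now apply metric_sym_fun|].
    apply (metric_signature h hh).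
  - intros. now apply christoffel_compatible.
  - intros l k x y. now apply riemann_curvature.
Qed.

(** * From zero curvature to flatness, and from the foliation to a null gradient *)

Lemma riemann_flip h l k i j x y : riemann h l k j i x y = - riemann h l k i j x y.
Proof. unfold riemann, sum_axis. ring. Qed.

Lemma curvature_zero_flat h : lorentzian_metric h ->
  (forall x y, curvature h x y = 0) -> flat h.
Proof.
  intros hh Hz l k i j x y.
  assert (R : riemann h l k ax ay x y = 0) by (rewrite riemann_curvature, Hz by exact hh; ring).
  destruct i, j.
  - unfold riemann, sum_axis. ring.
  - exact R.
  - rewrite riemann_flip, R. ring.
  - unfold riemann, sum_axis. ring.
Qed.

(** In dimension two a covector that kills [v] is a multiple of [(v ay, - v ax)], and the cofactor
    matrix of [h] evaluated on that covector is [h(v, v)]. *)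
Lemma null_annihilator_grad_null h f x y (v : vec) : h ay ax = h ax ay ->
  (exists i, v i <> 0) -> apply2 h x y v v = 0 ->
  partial ax f x y * v ax + partial ay f x y * v ay = 0 ->
  cograd h f ax x y * partial ax f x y + cograd h f ay x y * partial ay f x y = 0.
Proof.
  intros Hs [i Hi] Hv Hf. unfold apply2, sum_axis in Hv. rewrite Hs in Hv.
  unfold cograd.
  set (p := partial ax f x y) in *. set (q := partial ay f x y) in *.
  set (E := h ax ax x y) in *. set (F := h ax ay x y) in *. set (G := h ay ay x y) in *.
  assert (Hn : v ax * v ax + v ay * v ay <> 0) by (destruct i; nra).
  apply Rmult_eq_reg_l with (2 := Hn). rewrite Rmult_0_r.
  set (a := v ax) in *. set (b := v ay) in *.
  set (mu := p * b - q * a).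
  assert (Hp : (a * a + b * b) * p = mu * b).
  { transitivity (mu * b + a * (p * a + q * b)); [unfold mu; ring|rewrite Hf; ring]. }
  assert (Hq : (a * a + b * b) * q = - (mu * a)).
  { transitivity (- (mu * a) + b * (p * a + q * b)); [unfold mu; ring|rewrite Hf; ring]. }
  apply Rmult_eq_reg_l with (2 := Hn). rewrite Rmult_0_r.
  transitivity (G * ((a * a + b * b) * p) * ((a * a + b * b) * p)
    - 2 * F * ((a * a + b * b) * p) * ((a * a + b * b) * q)
    + E * ((a * a + b * b) * q) * ((a * a + b * b) * q)); [ring|].
  rewrite Hp, Hq.
  apply (f_equal (Rmult (mu * mu))) in Hv. lra.
Qed.

Theorem theorem3p1 (h : tensor2_field) (hh : lorentzian_metric h)
    (L : line_field) (hL : lightlike_foliation h L)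
    (hK : constant_on_leaves L (curvature h)) :
  flat h.
Proof.
  pose proof (lorentzian_metric_surface h hh) as S.
  apply curvature_zero_flat; [exact hh|].
  apply (null_gradient_flat h _ _ S). intros x y.
  destruct hL as [HL Hnull].
  destruct (leaf_direction L (curvature h) x y HL hK (surface_smooth_K _ _ _ S))
    as (v & Hv & HLv & Hd).
  apply null_annihilator_grad_null with v; auto.
  now apply metric_sym_fun.
Qed.
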